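(* Let $\alpha(y)$ be a smooth even function on $\mathbb{R}$ with compact support away from the origin. Let $P'(\alpha)$ be its co-Poisson summation: $$P'(\alpha)(y) = \sum_{n\geq 1} \frac{\alpha(y/n)}{n} - \int_0^\infty \frac{\alpha(y)}{y}\,dy .$$ Then the additive Fourier transform of $P'(\alpha)$ is $P'(I(\alpha))$, where $I(\alpha)(y) = \alpha(1/y)/|y|$.
   Context: The additive Fourier transform on $\mathbb{R}$ is $f\mapsto \big(w\mapsto\int_{\mathbb{R}} f(y)e^{2\pi i wy}\,dy\big)$. ''Compact support away from the origin'' means that the support is a compact subset of $\mathbb{R}\setminus\{0\}$; $I(\alpha)(0)$ is taken to be $0$, so that $I(\alpha)$ is again a smooth even function with compact support away from the origin. *)

(* Defs.v *)
From HB Require Import structures.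
From mathcomp Require Import all_boot all_order all_algebra.
From mathcomp Require Import all_classical all_reals all_analysis.
From mathcomp Require Import complex.

Set Implicit Arguments.
Unset Strict Implicit.
Unset Printing Implicit Defensive.

Import Order.TTheory GRing.Theory Num.Theory.
Import numFieldNormedType.Exports.

Local Open Scope classical_set_scope.
Local Open Scope ring_scope.
Local Open Scope complex_scope.

Section CoPoisson.
Context {R : realType}.

Local Notation mu := (@lebesgue_measure R).

(* There is no normed R-module structure on R[i], so calculus on complex-valued
   functions of a real variable (derivatives, integrals, series) is done on real
   and imaginary parts. *)
Definition rsmooth (f : R -> R) : Prop :=
  forall (n : nat) (x : R), derivable (derive1n n f) x 1.

Definition csmooth (f : R -> R[i]) : Prop :=
  rsmooth (fun x => complex.Re (f x)) /\ rsmooth (fun x => complex.Im (f x)).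

Definition even_fun (f : R -> R[i]) : Prop := forall x, f (- x) = f x.

Definition csupport (f : R -> R[i]) : set R := closure [set x | f x != 0].

Definition compact_support_away0 (f : R -> R[i]) : Prop :=
  compact (csupport f) /\ ~ csupport f 0.

Definition cintegrable (D : set R) (f : R -> R[i]) : Prop :=
  mu.-integrable D (fun x => (complex.Re (f x))%:E) /\
  mu.-integrable D (fun x => (complex.Im (f x))%:E).

Definition cintegral (D : set R) (f : R -> R[i]) : R[i] :=
  (\int[mu]_(x in D) complex.Re (f x)) +i* (\int[mu]_(x in D) complex.Im (f x)).

Definition cseries (u : nat -> R[i]) : R[i] :=
  (limn (series (fun n => complex.Re (u n))) : R)
  +i* limn (series (fun n => complex.Im (u n))).

(* e^(i t) *)
Definition expi (t : R) : R[i] := cos t +i* sin t.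

Definition fourier (f : R -> R[i]) (w : R) : R[i] :=
  cintegral setT (fun y => f y * expi (2 * pi * w * y)).

(* Integrability is required because [cintegral] is total: [fourier f] is only
   meaningful for [f] in L^1. *)
Definition has_fourier (f g : R -> R[i]) : Prop :=
  cintegrable setT f /\ forall w, fourier f w = g w.

(* The sum over n >= 1 is indexed from 0 by shifting n to n.+1. When a has
   compact support away from 0, only finitely many terms of the sum are nonzero
   and a t / t is integrable on ]0, +oo[, so neither takes a default value. *)
Definition coPoisson (a : R -> R[i]) (y : R) : R[i] :=
  cseries (fun n => a (y / n.+1%:R) / n.+1%:R)
  - cintegral `]0, +oo[ (fun t => a t / t%:C).

Definition inversion (a : R -> R[i]) (y : R) : R[i] :=
  if y == 0 then 0 else a y^-1 / `|y|%:C.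

End CoPoisson.

(* Main.v *)
Require Import Defs.
From mathcomp Require Import all_boot all_order all_algebra.
From mathcomp Require Import all_classical all_reals all_analysis.
From mathcomp Require Import measurable_realfun complex ring lra zify.

Set Implicit Arguments.
Unset Strict Implicit.
Unset Printing Implicit Defensive.

Import Order.TTheory GRing.Theory Num.Theory.
Import numFieldNormedType.Exports.

Local Open Scope classical_set_scope.
Local Open Scope ring_scope.
Local Open Scope complex_scope.

(* Let P = P'(alpha) and w > 0. Two integrations by parts against cos (2 pi w y)
   remove the constant term of P, and leave the absolutely convergent sum over n of
   n^-2 times the cosine integral of alpha'' at frequency n w, that is, the
   integral of alpha'' against sum_n cos (2 pi n w v) / n^2. This Fourier series is
   pi^2 (x - 1/2)^2, x the fractional part of w v, up to an additive constant that
   does not matter because alpha'' has integral 0. Two integrations by parts on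
   every period (Euler-Maclaurin) then give the sum over n of alpha (n / w) / w minus
   the integral of alpha, which is P'(I(alpha))(w). Moreover P(y) is the error of
   the Riemann sum of mesh 1 / y for the smooth function alpha (1 / u) / u, hence
   O(1 / y^2), so that P is integrable. The value at w = 0 follows by continuity. *)

(** * Mean value inequality and primitives *)

Section RealCalculus.
Context {R : realType}.
Implicit Types (f g : R -> R) (a b c x : R).

Local Notation mu := (@lebesgue_measure R).

Lemma is_derive_continuous f x l : is_derive x 1 f l -> {for x, continuous f}.
Proof. by case=> /derivable1_diffP/differentiable_continuous. Qed.

(** By the mean value theorem. The bound on the derivative is asked only on the open interval,
    because later bounds hold by construction only strictly inside a period or strictly beyond the
    support. *)
Lemma norm_increment_le f f' a b c : a <= b ->
  (forall x, a <= x <= b -> is_derive x 1 f (f' x)) ->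
  (forall x, a < x < b -> `|f' x| <= c) ->
  `|f b - f a| <= c * (b - a).
Proof.
rewrite le_eqVlt => /predU1P[<- _ _|ab df le_c]; first by rewrite !subrr normr0 mulr0.
have [||x] := @MVT R f f' a b ab.
- by move=> x /[!in_itv]/= /andP[ax xb]; apply: df; rewrite !ltW.
- apply: derivable_within_continuous => x /[!in_itv]/= xab.
  by case: (df _ xab).
- rewrite in_itv/= => xab ->.
  have ba0 : 0 <= b - a by rewrite subr_ge0 ltW.
  by rewrite normrM (ger0_norm ba0) ler_wpM2r// le_c.
Qed.

Lemma eq_of_derive0 f a b : a <= b ->
  (forall x, a <= x <= b -> is_derive x 1 f 0) -> f b = f a.
Proof.
move=> ab df; apply/eqP; rewrite -subr_eq0 -normr_le0 -(mul0r (b - a)).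
by apply: (@norm_increment_le _ (cst 0)) => // x _; rewrite normr0.
Qed.

(** The integral from [b] is differentiated only beyond [b]. Callers start it to the left of the
    points they need, so that the derivative exists at closed endpoints too. *)
Lemma primitive_right f b : continuous f ->
  exists F, forall x, b < x -> is_derive x 1 F (f x).
Proof.
move=> cf; exists (fun x => \int[mu]_(t in `[b, x]) f t) => x bx.
have x1 : x < x + 1 by rewrite ltrDl.
have [||d1 <-] := @continuous_FTC1_closed R f b x (x + 1) x1 _ bx.
- apply: continuous_compact_integrable; first exact: segment_compact.
  exact: continuous_subspaceT.
- exact: cf.
- by rewrite derive1E; exact/derivableP.
Qed.

Lemma Rintegral_primitive f F a b : a < b ->
  {within `[a, b], continuous f} ->
  (forall x, a <= x <= b -> is_derive x 1 F (f x)) ->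
  \int[mu]_(x in `[a, b]) f x = F b - F a.
Proof.
move=> ab cf dF; rewrite /Rintegral (@continuous_FTC2 R f F a b)//.
- split.
  + by move=> x /[!in_itv]/= /andP[ax xb]; case: (dF x); rewrite ?ltW.
  + apply: cvg_at_right_filter.
    by apply/(@is_derive_continuous F a (f a)); apply: dF; rewrite lexx ltW.
  + apply: cvg_at_left_filter.
    by apply/(@is_derive_continuous F b (f b)); apply: dF; rewrite lexx ltW.
- move=> x /[!in_itv]/= /andP[ax xb]; rewrite derive1E.
  by apply: derive_val; apply: dF; rewrite !ltW.
Qed.

(** Telescoping: 1 / (n + 1)^2 is at most 1 / n - 1 / (n + 1). The induction carries the sharper
    bound 1 / M - 1 / N. *)
Lemma sum_inv_sqr_le M N : (0 < M <= N)%N ->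
  \sum_(M <= n < N) ((n.+1%:R : R) ^- 2) <= M%:R^-1.
Proof.
move=> /andP[M0 MN]; apply: (@le_trans _ _ (M%:R^-1 - N%:R^-1)); last first.
  by rewrite gerBl invr_ge0.
rewrite -(subnKC MN); elim: (N - M)%N => [|k IH]; first by rewrite addn0 big_geq// subrr.
rewrite addnS big_nat_recr/= ?leq_addr//.
apply: (le_trans (lerD IH (lexx _))).
have p0 : 0 < (M + k)%:R :> R by rewrite ltr0n addn_gt0 M0.
rewrite -!natr1; move: {IH}(_%:R) p0 => p p0.
rewrite -subr_ge0.
have -> : M%:R^-1 - (p + 1)^-1 - (M%:R^-1 - p^-1 + (p + 1) ^- 2) =
    (p * (p + 1) ^+ 2)^-1.
  by field; rewrite !gt_eqF ?ltr_wpDr// ltr0n.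
by rewrite invr_ge0 mulr_ge0 ?ltW ?exprn_gt0 ?ltr_wpDr.
Qed.

(** * Derivative rules for explicit lambda terms *)

Section EtaDerivatives.
Variable x : R.

Lemma der1_congr f a b : is_derive x 1 f a -> a = b -> is_derive x 1 f b.
Proof. by move=> df <-. Qed.

Lemma der1_cst c : is_derive x 1 (fun=> c) 0.
Proof. exact: is_derive_cst. Qed.

Lemma der1_id : is_derive x 1 (fun y : R => y) 1.
Proof. exact: is_derive_id. Qed.

Lemma der1_add f g a b : is_derive x 1 f a -> is_derive x 1 g b ->
  is_derive x 1 (fun y => f y + g y) (a + b).
Proof. by move=> df dg; exact: is_deriveD. Qed.

Lemma der1_opp f a : is_derive x 1 f a -> is_derive x 1 (fun y => - f y) (- a).
Proof. by move=> df; exact: is_deriveN. Qed.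

Lemma der1_mul f g a b : is_derive x 1 f a -> is_derive x 1 g b ->
  is_derive x 1 (fun y => f y * g y) (f x * b + g x * a).
Proof. by move=> df dg; exact: (@is_deriveM R R f g x 1 a b). Qed.

Lemma der1_comp f g a b : is_derive (f x) 1 g b -> is_derive x 1 f a ->
  is_derive x 1 (fun y => g (f y)) (b * a).
Proof. by move=> dg df; apply: is_derive_eq; rewrite mulrC. Qed.

Lemma der1_exp f n a : is_derive x 1 f a ->
  is_derive x 1 (fun y => f y ^+ n.+1) (n.+1%:R * f x ^+ n * a).
Proof.
move=> df; elim: n => [|n IH].
  by apply: der1_congr df _; rewrite expr0 !mul1r.
under eq_fun do rewrite exprS.
by apply: der1_congr (der1_mul df IH) _; rewrite -[in RHS]natr1 exprS; ring.
Qed.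

Lemma der1_inv f a : f x != 0 -> is_derive x 1 f a ->
  is_derive x 1 (fun y => (f y)^-1) (- (f x) ^- 2 * a).
Proof. by move=> f0 df; exact: (@is_deriveV R f x a 1). Qed.

Lemma der1_sum N (f : nat -> R -> R) (df : nat -> R) :
  (forall n, (n < N)%N -> is_derive x 1 (f n) (df n)) ->
  is_derive x 1 (fun y => \sum_(n < N) f n y) (\sum_(n < N) df n).
Proof.
elim: N => [_|N IH df_].
  by under eq_fun do rewrite big_ord0; rewrite big_ord0; exact: der1_cst.
under eq_fun do rewrite big_ord_recr/=; rewrite big_ord_recr/=.
by apply: der1_add; [apply: IH => n nN; apply: df_; exact: ltnW|exact: df_].
Qed.

End EtaDerivatives.

End RealCalculus.

(** Differentiates along the syntax of the function, taking derivatives of unknown functions from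
    the context. After [der_eq], the derivative so found is compared with the expected one in a
    separate goal. *)
Ltac der := repeat first
  [ eassumption
  | notypeclasses refine (der1_cst _ _) | notypeclasses refine (der1_id _)
  | notypeclasses refine (der1_add _ _) | notypeclasses refine (der1_opp _)
  | notypeclasses refine (der1_mul _ _) | notypeclasses refine (der1_exp _ _)
  | notypeclasses refine (der1_comp (is_derive_cos _) _)
  | notypeclasses refine (der1_comp (is_derive_sin _) _)].

Ltac der_eq := notypeclasses refine (der1_congr _ _).

(** * The Fourier series of the second Bernoulli polynomial *)

Section SquareCosineSeries.
Context {R : realType}.
Implicit Types t : R.

Definition cosker M t : R :=
  \sum_(n < M) cos (2 * pi * n.+1%:R * t) / n.+1%:R ^+ 2.

Definition sinker M t : R :=
  - (2 * pi) * \sum_(n < M) sin (2 * pi * n.+1%:R * t) / n.+1%:R.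

Lemma is_derive_cosker M t : is_derive t 1 (cosker M) (sinker M t).
Proof.
rewrite /cosker /sinker mulr_sumr.
apply: (@der1_sum _ t M (fun n t => cos (2 * pi * n.+1%:R * t) / n.+1%:R ^+ 2)
  (fun n => - (2 * pi) * (sin (2 * pi * n.+1%:R * t) / n.+1%:R))) => n _.
have n0 : n.+1%:R != 0 :> R by rewrite pnatr_eq0.
by der_eq; [der|move: (n.+1%:R) n0 => m n0 /=; field].
Qed.

Lemma is_derive_sinker M t : is_derive t 1 (sinker M)
  (- (2 * pi) ^+ 2 * \sum_(n < M) cos (2 * pi * n.+1%:R * t)).
Proof.
have ds := @der1_sum _ t M (fun n t => sin (2 * pi * n.+1%:R * t) / n.+1%:R)
  (fun n => (2 * pi) * cos (2 * pi * n.+1%:R * t)).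
apply: (der1_congr (der1_mul (der1_cst t (- (2 * pi))) (ds _))) => [n _|].
  have n0 : n.+1%:R != 0 :> R by rewrite pnatr_eq0.
  by der_eq; [der|move: (n.+1%:R) n0 => m n0 /=; field].
by rewrite -mulr_sumr; ring.
Qed.

(** Closed form of the Dirichlet kernel, by telescoping 2 cos (2 n x) sin x = sin ((2 n + 1) x) -
    sin ((2 n - 1) x) with x = pi t. *)
Lemma dirichlet_sum M t :
  (\sum_(n < M) cos (2 * pi * n.+1%:R * t)) * (2 * sin (pi * t)) =
  sin ((2 * M + 1)%:R * (pi * t)) - sin (pi * t).
Proof.
elim: M => [|M IH]; first by rewrite big_ord0 mul0r mul1r subrr.
rewrite big_ord_recr/= mulrDl IH.
have -> : (2 * M + 1)%:R * (pi * t) = 2 * pi * M.+1%:R * t - pi * t.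
  by rewrite -natr1 natrD natrM; ring.
have -> : (2 * M.+1 + 1)%:R * (pi * t) = 2 * pi * M.+1%:R * t + pi * t.
  by rewrite natrD natrM; ring.
rewrite sinB sinD; ring.
Qed.

Lemma sin_natmul_pi n : sin (n%:R * pi) = 0 :> R.
Proof.
elim: n => [|n IH]; first by rewrite mul0r sin0.
by rewrite -natr1 mulrDl mul1r sinDpi IH oppr0.
Qed.

Lemma sinker_half M : sinker M 2^-1 = 0 :> R.
Proof.
rewrite /sinker big1 ?mulr0// => n _.
have -> : 2 * pi * n.+1%:R * 2^-1 = n.+1%:R * pi :> R by field.
by rewrite sin_natmul_pi mul0r.
Qed.

Lemma cos_odd_half_pi M : cos ((2 * M + 1)%:R * (pi * 2^-1)) = 0 :> R.
Proof.
have -> : (2 * M + 1)%:R * (pi * 2^-1) = M%:R * pi + pi / 2 :> R.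
  by rewrite natrD natrM; field.
by rewrite cosDpihalf sin_natmul_pi oppr0.
Qed.

Lemma cos_add_natmul_2pi t n : cos (t + 2 * pi * n%:R) = cos t.
Proof.
elim: n => [|n IH]; first by rewrite mulr0 addr0.
have -> : t + 2 * pi * n.+1%:R = t + 2 * pi * n%:R + pi *+ 2.
  by rewrite -natr1 mulr2n; ring.
by rewrite cosD2pi IH.
Qed.

Lemma cosker_periodic M k t : cosker M (t + k%:R) = cosker M t.
Proof.
apply: eq_bigr => n _; congr (_ / _).
rewrite -[RHS](cos_add_natmul_2pi _ (n.+1 * k)); congr cos.
by rewrite natrM; ring.
Qed.

Lemma cosker_onem M t : cosker M (1 - t) = cosker M t.
Proof.
apply: eq_bigr => n _; congr (_ / _).
rewrite -[RHS]cosN -[RHS](cos_add_natmul_2pi _ n.+1); congr cos.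
by ring.
Qed.

Lemma cosker_sub_le M N t : (0 < M <= N)%N ->
  `|cosker N t - cosker M t| <= M%:R^-1.
Proof.
move=> MN; apply: (le_trans _ (sum_inv_sqr_le MN)).
rewrite /cosker -!(big_mkord xpredT (fun n => cos (2 * pi * n.+1%:R * t) / n.+1%:R ^+ 2)).
case/andP: MN => M0 MN.
rewrite (big_cat_nat (n := M))//= [X in `|X|]addrC addKr.
apply: le_trans (ler_norm_sum _ _ _) _; apply: ler_sum => n _.
rewrite normrM [X in _ * X]ger0_norm ?invr_ge0 ?exprn_ge0//.
by rewrite ler_piMl ?cos_max// invr_ge0 exprn_ge0.
Qed.

(** Normalised to vanish at 1/2, the base point of the estimates below: the constant term of the
    Fourier series is replaced by the explicit [cosker M 2^-1]. *)
Definition cosker_error M t : R :=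
  cosker M t - cosker M 2^-1 - pi ^+ 2 * (t - 2^-1) ^+ 2.

Lemma is_derive_cosker_error M t : is_derive t 1 (cosker_error M)
  (sinker M t - 2 * pi ^+ 2 * (t - 2^-1)).
Proof.
have dk := is_derive_cosker M t.
by rewrite /cosker_error; der_eq; [der|rewrite /=; ring].
Qed.

(* Adding a multiple of cos ((2 M + 1) pi t) / sin (pi t) is an integration by
   parts of the Dirichlet kernel: it turns the derivative of the error, whose own
   derivative is only bounded, into a function with derivative O(1 / M). *)
Lemma cosker_error_pointwise t : 0 < t < 1 ->
  exists c, forall M, `|cosker_error M t| <= c / (2 * M + 1)%:R.
Proof.
(* Everything is symmetric about 1/2, so the left half of the period suffices. There [sin (pi * u)]
   increases, and its value [s] at t bounds the denominators from below. *)
wlog th : t / t <= 2^-1 => [hw t01|/andP[t0 _]].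
  have [|ht] := leP t 2^-1; first by move=> th; apply: hw.
  have [||c hc] := hw (1 - t); [by lra|by lra|].
  exists c => M; have := hc M; rewrite /cosker_error cosker_onem.
  by rewrite (_ : 1 - t - 2^-1 = - (t - 2^-1)) ?sqrrN//; field.
have pi0 := pi_gt0 R.
pose s := sin (pi * t).
have s0 : 0 < s.
  apply: sin_gt0_pi; rewrite mulr_gt0//= -[X in _ < X]mulr1 ltr_pM2l//; lra.
have le_s u : t <= u <= 2^-1 -> s <= sin (pi * u).
  move=> /andP[+ u1]; rewrite le_eqVlt => /predU1P[<-//|tu].
  rewrite ltW// ltr_sin ?ltr_pM2l// in_itv/= !ler_pM2l//; apply/andP; split; try lra.
    by apply: (@le_trans _ _ 0); [rewrite oppr_le0 divr_ge0 ?ltW|rewrite mulr_ge0 ?ltW].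
  by apply: (@le_trans _ _ 0); [rewrite oppr_le0 divr_ge0 ?ltW|rewrite mulr_ge0 ?ltW//; lra].
exists (pi ^+ 2 / s ^+ 2 + 2 * pi / s) => M.
set m : R := (2 * M + 1)%:R.
have m0 : 0 < m by rewrite ltr0n addn1.
pose E u := sinker M u - 2 * pi ^+ 2 * (u - 2^-1)
  - 2 * pi / m * cos (m * (pi * u)) / sin (pi * u).
pose E' u := 2 * pi ^+ 2 / m * (cos (m * (pi * u)) * cos (pi * u) / sin (pi * u) ^+ 2).
have sn0 u : t <= u <= 2^-1 -> 0 < sin (pi * u) by move=> /le_s; exact: lt_le_trans.
have dE u : t <= u <= 2^-1 -> is_derive u 1 E (E' u).
  move=> ut; have sne : sin (pi * u) != 0 by rewrite gt_eqF// sn0.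
  have dk := is_derive_sinker M u.
  have ds : is_derive u 1 (fun u => sin (pi * u)) (cos (pi * u) * pi).
    by der_eq; [der|rewrite /=; ring].
  have dv := der1_inv sne ds.
  rewrite /E; der_eq; [der|].
  (* The closed form cancels the term in [sin (m * (pi * u))] and the constant 2 pi^2; what remains
     carries a factor 1 / m. *)
  have /(congr1 ( *%R^~ (sin (pi * u))^-1)) := dirichlet_sum M u.
  rewrite -/m => dir.
  have -> : \sum_(n < M) cos (2 * pi * n.+1%:R * u) =
      (sin (m * (pi * u)) - sin (pi * u)) / (2 * sin (pi * u)).
    by rewrite -dirichlet_sum mulfK// mulf_neq0.
  rewrite /E' /=; field.
  by rewrite sne gt_eqF.
(* [E] vanishes at 1/2, since [sinker] does and m is odd. The segment has length at most 1/2, which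
   absorbs the factor 2 of [E']. *)
have leE u : t <= u <= 2^-1 -> `|E u| <= pi ^+ 2 / s ^+ 2 / m.
  move=> /andP[tu u1]; rewrite -normrN -sub0r.
  have -> : 0 = E 2^-1.
    by rewrite /E sinker_half cos_odd_half_pi !(subrr, mulr0, mul0r).
  apply: (@le_trans _ _ (2 * (pi ^+ 2 / s ^+ 2 / m) * (2^-1 - u))).
    apply: (@norm_increment_le _ E E' u 2^-1 _ u1) => [v /andP[uv v1]|v /andP[uv v1]].
      by apply: dE; rewrite v1 (le_trans tu).
    have vt : t <= v <= 2^-1 by rewrite (ltW v1) (le_trans tu)// ltW.
    have pm0 : 0 < 2 * pi ^+ 2 / m by rewrite divr_gt0// mulr_gt0// exprn_gt0.
    have -> : 2 * (pi ^+ 2 / s ^+ 2 / m) = 2 * pi ^+ 2 / m * s ^- 2.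
      by move: s0 m0; clearbody s m => s0 m0; field; rewrite !gt_eqF.
    rewrite /E' normrM (gtr0_norm pm0) ler_pM2l// !normrM normfV.
    rewrite -[leRHS]mul1r; apply: ler_pM; rewrite ?invr_ge0 ?mulr_ge0//.
      by rewrite -[leRHS]mulr1 ler_pM// cos_max.
    rewrite ger0_norm ?exprn_ge0 ?(ltW (sn0 _ vt))//.
    rewrite lef_pV2 ?posrE ?exprn_gt0 ?(sn0 v)//.
    by rewrite ler_pXn2r ?nnegrE ?le_s ?(ltW (sn0 v vt)) ?(ltW s0).
  have C0 : 0 <= pi ^+ 2 / s ^+ 2 / m.
    by rewrite !divr_ge0 ?exprn_ge0// ltW.
  move: (_ / m) C0 => C C0.
  rewrite -subr_ge0 (_ : _ - _ = C * (2 * u)); last by field.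
  by rewrite !mulr_ge0// ltW// (lt_le_trans t0).
have led u : t <= u <= 2^-1 ->
    `|sinker M u - 2 * pi ^+ 2 * (u - 2^-1)| <= (pi ^+ 2 / s ^+ 2 + 2 * pi / s) / m.
  move=> ut; rewrite -[X in `|X|](subrK (2 * pi / m * cos (m * (pi * u)) / sin (pi * u))).
  apply: (le_trans (ler_normD _ _)); rewrite [leRHS]mulrDl; apply: lerD; first exact: leE.
  have pm0 : 0 < 2 * pi / m by rewrite divr_gt0// mulr_gt0.
  rewrite [leRHS]mulrAC -mulrA normrM (gtr0_norm pm0) ler_pM2l// normrM normfV.
  rewrite (gtr0_norm (sn0 _ ut)) -[leRHS]mul1r ler_pM ?invr_ge0 ?cos_max ?(ltW (sn0 _ ut))//.
  by rewrite lef_pV2 ?posrE ?(sn0 u)// le_s.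
rewrite -normrN -sub0r.
have -> : 0 = cosker_error M 2^-1 by rewrite /cosker_error !subrr expr0n/= mulr0 subrr.
apply: (le_trans (@norm_increment_le _ _ _ _ _ ((pi ^+ 2 / s ^+ 2 + 2 * pi / s) / m) th
   (fun u _ => is_derive_cosker_error M u) _)) => [u /andP[tu u1]|].
  by apply: led; rewrite !ltW.
rewrite ler_piMr//; last lra.
by rewrite divr_ge0 ?addr_ge0 ?divr_ge0 ?mulr_ge0 ?exprn_ge0// ltW.
Qed.

(** The constant in [cosker_error_pointwise] depends on t. Uniformity comes from the tails: the
    errors of orders M and N differ by two tails of the series, at t and at 1/2, each at most 1 / M,
    and the error of order N tends to 0 at t. *)
Lemma cosker_error_le M t : (0 < M)%N -> 0 < t < 1 ->
  `|cosker_error M t| <= 2 / M%:R.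
Proof.
move=> M0 t01; have [c hc] := cosker_error_pointwise t01.
apply/ler_addgt0Pr => e e0.
have [N [MN cN]] : exists N, (M <= N)%N /\ c / (2 * N + 1)%:R <= e.
  exists (maxn M (Num.truncn `|c / e|).+1); split; first exact: leq_maxl.
  set N := maxn _ _.
  rewrite ler_pdivrMr ?ltr0n ?addn1// mulrC -ler_pdivrMr//.
  apply: (le_trans (ler_norm _)); apply: ltW.
  apply: (lt_le_trans (truncnS_gt _)).
  by rewrite ler_nat (@leq_trans N) ?leq_maxr//; lia.
rewrite -[X in `|X|](subrK (cosker_error N t)) (le_trans (ler_normD _ _))//.
apply: lerD; last exact: le_trans (hc N) cN.
have -> : cosker_error M t - cosker_error N t =
    - (cosker N t - cosker M t) + (cosker N 2^-1 - cosker M 2^-1).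
  by rewrite /cosker_error; ring.
apply: (le_trans (ler_normD _ _)); rewrite normrN mulrDl mul1r.
by rewrite lerD// cosker_sub_le// M0 MN.
Qed.

End SquareCosineSeries.

(** * Error of the trapezoidal rule *)

Section Trapezoid.
Context {R : realType}.

(** As a function of the right endpoint x, the error has derivative (g p - g x + (x - p) g' x) / 2,
    whose numerator has derivative (x - p) g'' x. Two mean value inequalities conclude, with a
    constant that is not sharp. *)
Lemma trapezoid_error_le (g g1 g2 Phi : R -> R) (p q c : R) : p <= q ->
  (forall x, p <= x <= q -> is_derive x (1 : R) g (g1 x)) ->
  (forall x, p <= x <= q -> is_derive x (1 : R) g1 (g2 x)) ->
  (forall x, p <= x <= q -> is_derive x (1 : R) Phi (g x)) ->
  (forall x, p <= x <= q -> `|g2 x| <= c) ->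
  `|(q - p) * (g p + g q) / 2 - (Phi q - Phi p)| <= c * (q - p) ^+ 3 / 2.
Proof.
move=> pq dg dg1 dP g2c.
have c0 : 0 <= c by rewrite (le_trans _ (g2c p _)) ?lexx.
have slope x : p <= x <= q -> `|g p - g x + (x - p) * g1 x| <= c * (q - p) * (x - p).
  move=> /andP[px xq].
  have -> : g p - g x + (x - p) * g1 x =
      (g p - g x + (x - p) * g1 x) - (g p - g p + (p - p) * g1 p) by ring.
  apply: (@norm_increment_le _ (fun x => g p - g x + (x - p) * g1 x)
    (fun x => (x - p) * g2 x) p x _ px) => [z|z] /andP[pz zx].
    have zpq : p <= z <= q by rewrite pz (le_trans zx).
    have d0 := dg z zpq; have d1 := dg1 z zpq.
    by der_eq; [der|rewrite /=; ring].
  have zq : z <= q by rewrite (le_trans (ltW zx)).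
  rewrite normrM mulrC ler_pM ?g2c ?(ltW pz)//.
  by rewrite ger0_norm ?subr_ge0 ?(ltW pz)// lerD2r.
pose E x := (x - p) * (g p + g x) / 2 - Phi x.
have -> : (q - p) * (g p + g q) / 2 - (Phi q - Phi p) = E q - E p.
  by rewrite /E; ring.
have -> : c * (q - p) ^+ 3 / 2 = c * (q - p) ^+ 2 / 2 * (q - p) by ring.
apply: (@norm_increment_le _ E (fun x => (g p - g x + (x - p) * g1 x) / 2) p q _ pq).
  move=> x xpq; have d0 := dg x xpq; have d1 := dP x xpq.
  by rewrite /E; der_eq; [der|rewrite /=; field].
move=> x /andP[px xq]; rewrite normrM [X in _ * X]ger0_norm// ler_pM2r//.
apply: (le_trans (slope _ _)); first by rewrite !ltW.
by rewrite expr2 mulrA ler_wpM2l ?mulr_ge0 ?subr_ge0// lerD2r ltW.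
Qed.

End Trapezoid.

Lemma cosM_continuous {R : realType} (b : R) : continuous (fun y : R => cos (b * y)).
Proof.
by move=> y; apply: continuous_comp; [exact: mulrl_continuous|exact: continuous_cos].
Qed.

Lemma sinM_continuous {R : realType} (b : R) : continuous (fun y : R => sin (b * y)).
Proof.
by move=> y; apply: continuous_comp; [exact: mulrl_continuous|exact: continuous_sin].
Qed.

(** * Integrals over the line *)

Section IntegralLimits.
Context {R : realType}.
Implicit Types f g : R -> R.
Local Notation mu := (@lebesgue_measure R).

Lemma integrable_oneDsqrV : mu.-integrable setT (EFin \o (fun x : R => (oneDsqr x)^-1)).
Proof.
have cV : continuous (fun x : R => (oneDsqr x)^-1) by exact: continuous_oneDsqrV.
have V0 (x : R) : 0 <= (oneDsqr x)^-1.
  by rewrite invr_ge0 (le_trans ler01)// oneDsqr_ge1.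
apply/integrableP; split.
  by apply/measurable_EFinP; exact: continuous_measurable_fun cV.
under eq_integral do rewrite /= ger0_norm//.
rewrite ge0_symfun_integralT//; last by move=> x; rewrite /= /oneDsqr sqrrN.
by rewrite -set_itvcy integral0y_oneDsqr ltry.
Qed.

Lemma integrable_mul_bounded f g : mu.-integrable setT (EFin \o f) ->
  continuous g -> (forall y : R, `|g y| <= 1) ->
  mu.-integrable setT (EFin \o (fun y => f y * g y)).
Proof.
move=> fi cg g1.
apply: (@le_integrable _ _ R mu setT measurableT _ (EFin \o f)) => //.
- apply/measurable_EFinP; apply: measurable_funM.
    by apply/measurable_EFinP; exact: measurable_int fi.
  exact: continuous_measurable_fun.
- by move=> y _; rewrite lee_fin/= normrM -[leRHS]mulr1 ler_wpM2l.
Qed.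

Lemma Rintegral_dominated_cvg (f_ : nat -> R -> R) f g :
  (forall n, measurable_fun setT (f_ n)) -> measurable_fun setT f ->
  (forall x, f_ n x @[n --> \oo] --> f x) ->
  mu.-integrable setT (EFin \o g) -> (forall n x, `|f_ n x| <= g x) ->
  \int[mu]_x f_ n x @[n --> \oo] --> \int[mu]_x f x.
Proof.
move=> mf_ mf cf ig le_g.
have [||||| fi _ fc] := @dominated_convergence _ _ R mu setT measurableT
  (fun n => EFin \o f_ n) (EFin \o f) (EFin \o g).
- by move=> n; apply/measurable_EFinP; exact: mf_.
- exact/measurable_EFinP.
- by apply: aeW => x _; apply: cvg_EFin; [exact: nearW|exact: cf].
- exact: ig.
- by apply: aeW => x n _; rewrite lee_fin.
- apply: fine_cvg; rewrite fineK//; exact: integrable_fin_num.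
Qed.

(** Dominated convergence with bound |f|: at each x the truncations are eventually equal to
    [f x]. *)
Lemma Rintegral_symm_segment_cvg f : mu.-integrable setT (EFin \o f) ->
  \int[mu]_(x in `[- n%:R, n%:R]) f x @[n --> \oo] --> \int[mu]_x f x.
Proof.
move=> fi; have mf : measurable_fun setT f.
  by apply/measurable_EFinP; exact: measurable_int fi.
under eq_cvg do rewrite Rintegral_mkcond.
apply: (@Rintegral_dominated_cvg _ _ (fun x => `|f x|)) => //.
- by move=> n; apply/(measurable_restrictT _ _).1 => //; exact: measurable_funTS.
- move=> x; apply: cvg_near_cst; near=> n.
  rewrite patchE mem_set//= in_itv/= -ler_norml.
  near: n; exact: nbhs_infty_ger.
- exact: integrable_norm fi.
- by move=> n x; rewrite patchE; case: ifP => // _; rewrite normr0.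
Unshelve. all: by end_near. Qed.

Lemma Rintegral_0y_primitive f F (a b : R) : 0 < a -> a < b ->
  (forall x, 0 < x -> ~~ (a <= x <= b) -> f x = 0) ->
  {within `[a, b], continuous f} ->
  (forall x, a <= x <= b -> is_derive x (1 : R) F (f x)) ->
  \int[mu]_(x in `]0, +oo[) f x = F b - F a.
Proof.
move=> a0 ab f0 cf dF; rewrite -(Rintegral_primitive ab cf dF).
rewrite Rintegral_mkcond [RHS]Rintegral_mkcond; congr (Rintegral _ _ _).
apply/funext => x; rewrite !patchE.
have [xab|xab] := boolP (a <= x <= b).
  rewrite !mem_set//= in_itv/= ?xab// andbT.
  by case/andP: xab => ax _; rewrite (lt_le_trans a0).
rewrite [X in _ = if X then _ else _]memNset/=; last by rewrite in_itv/=; exact/negP.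
by case: ifPn => //; rewrite inE/= in_itv/= andbT => x0; exact: f0.
Qed.

Lemma limn_series_finite (u : nat -> R) N :
  (forall n, (N <= n)%N -> u n = 0) -> limn (series u) = \sum_(n < N) u n.
Proof.
move=> u0; apply: cvg_lim => //; apply: cvg_near_cst; near=> n.
have Nn : (N <= n)%N by near: n; exact: nbhs_infty_ge.
rewrite seriesEnat/= (big_cat_nat (n := N))//= [X in _ + X]big_nat.
by rewrite [X in _ + X]big1 ?addr0 ?big_mkord// => k /andP[+ _]; exact: u0.
Unshelve. all: by end_near. Qed.

End IntegralLimits.

(** * Odd and even functions on symmetric segments *)

Section Parity.
Context {R : realType}.
Implicit Types (f F : R -> R) (k : R).
Local Notation mu := (@lebesgue_measure R).

Lemma Rintegral_symm_segment f k : 0 < k -> continuous f ->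
  exists2 G : R -> R, \int[mu]_(x in `[- k, k]) f x = G k - G (- k) &
    forall x, - k <= x <= k -> is_derive x 1 G (f x).
Proof.
move=> k0 cf; have [G dG] := primitive_right (- k - 1) cf.
have dGk x : - k <= x <= k -> is_derive x 1 G (f x).
  by case/andP => kx _; apply: dG; rewrite (lt_le_trans _ kx)// ltrBlDr ltrDl.
exists G => //; apply: Rintegral_primitive => //.
  by rewrite (lt_trans _ k0)// oppr_lt0.
exact: continuous_subspaceT.
Qed.

Let der1_reflect G (x l : R) : is_derive (- x) 1 G l -> is_derive x 1 (fun x => G (- x)) (- l).
Proof.
move=> dG; have := @der1_comp _ x (fun x => - x) G _ _ dG (der1_opp (der1_id x)).
by rewrite mulrN1.
Qed.

(** For a primitive [G], the function [G (- x) - G x] has derivative [- f (- x) - f x], which is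
    zero. *)
Lemma Rintegral_odd f k : 0 < k -> continuous f -> (forall x, f (- x) = - f x) ->
  \int[mu]_(x in `[- k, k]) f x = 0.
Proof.
move=> k0 cf fN; have [G -> dG] := Rintegral_symm_segment k0 cf.
suff GG : G (- k) - G k = G (- 0) - G 0.
  by apply/oppr_inj; rewrite opprB oppr0 GG oppr0 subrr.
apply: (@eq_of_derive0 _ (fun x => G (- x) - G x) 0 k (ltW k0)) => x /andP[x0 xk].
have xk' : - k <= - x <= k.
  by rewrite lerN2 xk lerNl (le_trans _ x0)// lerNl oppr0 ltW.
have d1 := der1_reflect (dG _ xk').
have d2 : is_derive x 1 G (f x).
  by apply: dG; rewrite xk (le_trans _ x0)// lerNl oppr0 ltW.
by der_eq; [der|rewrite fN; ring].
Qed.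

(** [F] is asked to be a primitive on [0, k] only, because the intended one, [cos_primitive], is
    differentiated only beyond -1. *)
Lemma Rintegral_even_primitive f F k : 0 < k -> continuous f -> (forall x, f (- x) = f x) ->
  (forall x : R, 0 <= x <= k -> is_derive x (1 : R) F (f x)) ->
  \int[mu]_(x in `[- k, k]) f x = 2 * (F k - F 0).
Proof.
move=> k0 cf fN dF; have [G -> dG] := Rintegral_symm_segment k0 cf.
suff GG : G k - G (- k) - 2 * F k = G 0 - G (- 0) - 2 * F 0.
  by rewrite -[LHS](subrK (2 * F k)) GG oppr0; ring.
apply: (@eq_of_derive0 _ (fun x => G x - G (- x) - 2 * F x) 0 k (ltW k0)) => x /andP[x0 xk].
have dFx : is_derive x 1 F (f x) by apply: dF; rewrite x0.
have xk' : - k <= - x <= k.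
  by rewrite lerN2 xk lerNl (le_trans _ x0)// lerNl oppr0 ltW.
have d1 := der1_reflect (dG _ xk').
have d2 : is_derive x 1 G (f x).
  by apply: dG; rewrite xk (le_trans _ x0)// lerNl oppr0 ltW.
by der_eq; [der|rewrite fN/=; ring].
Qed.

End Parity.

(** * The real co-Poisson sum *)

Section RealCoPoisson.
Context {R : realType}.
Local Notation mu := (@lebesgue_measure R).

Definition real_coPoisson (a : R -> R) (y : R) : R :=
  limn (series (fun n => a (y / n.+1%:R) / n.+1%:R))
  - \int[mu]_(t in `]0, +oo[) (a t / t).

Definition real_inversion (a : R -> R) (y : R) : R :=
  if y == 0 then 0 else a y^-1 / `|y|.

Lemma real_coPoissonN (a : R -> R) y : (forall x, a (- x) = a x) ->
  real_coPoisson a (- y) = real_coPoisson a y.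
Proof.
move=> aN; rewrite /real_coPoisson; congr (limn (series _) - _).
by apply/funext => n; rewrite mulNr aN.
Qed.

End RealCoPoisson.

(** * Real even functions with two derivatives, supported in an annulus *)

Section Bump.
Context {R : realType} (a a1 a2 : R -> R) (A B D : R).
Context (A0 : 0 < A) (AB : A < B).
Context (da : forall x : R, is_derive x 1 a (a1 x))
  (da1 : forall x : R, is_derive x 1 a1 (a2 x))
  (a2_continuous : continuous a2).
Context (a_supp : forall x : R, ~~ (A <= `|x| <= B) -> a x = 0)
  (a1_supp : forall x : R, ~~ (A <= `|x| <= B) -> a1 x = 0)
  (a2_supp : forall x : R, ~~ (A <= `|x| <= B) -> a2 x = 0).
Context (a_le : forall x, `|a x| <= D) (a1_le : forall x, `|a1 x| <= D)
  (a2_le : forall x, `|a2 x| <= D).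
Context (a_even : forall x, a (- x) = a x).
Local Notation mu := (@lebesgue_measure R).

Let B0 : 0 < B := lt_trans A0 AB.
Let D0 : 0 <= D := le_trans (normr_ge0 _) (a2_le 0).

Let gtB x : B < x -> ~~ (A <= `|x| <= B).
Proof.
by move=> Bx; rewrite negb_and -!ltNge ger0_norm ?Bx ?orbT// ltW// (lt_trans B0).
Qed.

Let supp0 : ~~ (A <= `|0 : R| <= B).
Proof. by rewrite negb_and -!ltNge normr0 A0. Qed.

(** For [p = 1] this is a partial sum of the co-Poisson series. Each differentiation brings out a
    factor 1 / n, hence the exponent. *)
Definition dilate_sum (f : R -> R) p N y : R :=
  \sum_(n < N) f (y / n.+1%:R) / n.+1%:R ^+ p.

Lemma is_derive_dilate_sum (f f' : R -> R) p N (y : R) :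
  (forall n, is_derive (y / n.+1%:R) 1 f (f' (y / n.+1%:R))) ->
  is_derive y 1 (dilate_sum f p N) (dilate_sum f' p.+1 N y).
Proof.
move=> df; apply: (@der1_sum _ y N (fun n y => f (y / n.+1%:R) / n.+1%:R ^+ p)
  (fun n => f' (y / n.+1%:R) / n.+1%:R ^+ p.+1)) => n _.
have n0 : n.+1%:R != 0 :> R by rewrite pnatr_eq0.
have d1 : is_derive y 1 (fun y => y / n.+1%:R : R) n.+1%:R^-1.
  by der_eq; [der|rewrite /=; ring].
have dc := @der1_comp _ y (fun y => y / n.+1%:R) f _ _ (df n) d1.
der_eq; [der|rewrite /= exprS invfM; ring].
Qed.

(** Only the terms from index M on survive, and they are controlled by the tail of the sum of 1 /
    n^2. It is applied for y > B M, where the first M arguments lie beyond the support. *)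
Lemma dilate_sum_tail_le (f : R -> R) c M N y :
  (0 < M <= N)%N -> (forall x, `|f x| <= c) ->
  (forall n, (n < M)%N -> f (y / n.+1%:R) = 0) ->
  `|dilate_sum f 2 N y| <= c / M%:R.
Proof.
move=> /andP[M0 MN] fc f0.
rewrite /dilate_sum -(big_mkord xpredT (fun n => f (y / n.+1%:R) / n.+1%:R ^+ 2)).
rewrite (big_cat_nat (n := M))//= big_nat big1 ?add0r; last first.
  by move=> n /andP[_ nM]; rewrite f0 ?mul0r.
apply: (@le_trans _ _ (c * \sum_(M <= n < N) n.+1%:R ^- 2)); last first.
  by rewrite ler_wpM2l ?sum_inv_sqr_le ?M0// (le_trans _ (fc 0)).
rewrite mulr_sumr; apply: le_trans (ler_norm_sum _ _ _) _; apply: ler_sum => n _.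
by rewrite normrM [X in _ * X]ger0_norm ?invr_ge0 ?exprn_ge0// ler_wpM2r ?invr_ge0 ?exprn_ge0.
Qed.

(* The primitives J n and Phi are only used on [0, +oo[; the bound -1 makes them
   differentiable at 0. *)
Section Frequency.
Context (w C : R) (J : nat -> R -> R) (Phi : R -> R).
Context (w0 : 0 < w) (J0 : forall n, J n 0 = 0)
  (dJ : forall n (v : R), -1 < v ->
    is_derive v 1 (J n) (a2 v * cos (2 * pi * w * n.+1%:R * v)))
  (dPhi : forall v : R, -1 < v -> is_derive v 1 Phi (a v)).

Let o := 2 * pi * w.
Let o0 : 0 < o.
Proof. by rewrite !mulr_gt0// pi_gt0. Qed.

Lemma J_increment_le n u v : 0 <= u -> u <= v -> `|J n v - J n u| <= D * (v - u).
Proof.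
move=> u0 uv; apply: (@norm_increment_le _ _ (fun v => a2 v * cos (2 * pi * w * n.+1%:R * v))
  u v _ uv) => x /andP[ux xv].
  by apply: dJ; lra.
by rewrite normrM -[leRHS]mulr1 ler_pM// cos_max.
Qed.

Lemma J_const n u v : B <= u -> u <= v -> J n v = J n u.
Proof.
move=> Bu uv; apply/eqP; rewrite -subr_eq0 -normr_le0 -(mul0r (v - u)).
apply: (@norm_increment_le _ _ (fun v => a2 v * cos (2 * pi * w * n.+1%:R * v))
  u v _ uv) => x /andP[ux xv].
  by apply: dJ; rewrite (lt_le_trans _ ux)// (lt_le_trans _ Bu)// (lt_trans _ B0)//; lra.
by rewrite a2_supp ?mul0r ?normr0// gtB// (le_lt_trans Bu).
Qed.

Lemma J_le n v : 0 <= v -> `|J n v| <= D * B.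
Proof.
have le_DB u : 0 <= u <= B -> `|J n u| <= D * B.
  move=> /andP[u0 uB]; have := J_increment_le n (lexx 0) u0.
  by rewrite J0 !subr0 => /le_trans; apply; rewrite ler_wpM2l.
move=> v0; have [vB|/ltW Bv] := leP v B; first by apply: le_DB; rewrite v0.
by rewrite (J_const n (lexx B) Bv) le_DB// ltW//=.
Qed.

(** The integral left by the two integrations by parts: v = y / n turns a''(y / n) cos (2 pi w y) /
    n^3 dy into a''(v) cos (2 pi n w v) / n^2 dv. *)
Definition J_sum N y : R := \sum_(n < N) J n (y / n.+1%:R) / n.+1%:R ^+ 2.

(** Two integrations by parts: a sine boundary term, a cosine boundary term and the remaining
    integral. [C] enters only the first, whose factor is the decaying co-Poisson sum once N is
    large. *)
Definition cos_primitive N y : R :=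
  (dilate_sum a 1 N y - C) * sin (o * y) / o
  + dilate_sum a1 2 N y * cos (o * y) / o ^+ 2
  - J_sum N y / o ^+ 2.

Lemma is_derive_cos_primitive N (y : R) : -1 < y -> is_derive y 1 (cos_primitive N)
  ((dilate_sum a 1 N y - C) * cos (o * y)).
Proof.
move=> y1.
have ds := @is_derive_dilate_sum a a1 1 N y (fun n => da (y / n.+1%:R)).
have ds1 := @is_derive_dilate_sum a1 a2 2 N y (fun n => da1 (y / n.+1%:R)).
have dJs : is_derive y 1 (J_sum N) (dilate_sum a2 3 N y * cos (o * y)).
  rewrite mulr_suml.
  apply: (@der1_sum _ y N (fun n y => J n (y / n.+1%:R) / n.+1%:R ^+ 2)
    (fun n => a2 (y / n.+1%:R) / n.+1%:R ^+ 3 * cos (o * y))) => n _.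
  have n0 : n.+1%:R != 0 :> R by rewrite pnatr_eq0.
  have d1 : is_derive y 1 (fun y => y / n.+1%:R : R) n.+1%:R^-1.
    by der_eq; [der|rewrite /=; ring].
  have yn : -1 < y / n.+1%:R.
    rewrite ltr_pdivlMr ?ltr0n// (le_lt_trans _ y1)// mulN1r lerN2.
    by rewrite (ler_nat R 1).
  have dc := @der1_comp _ y (fun y => y / n.+1%:R) (J n) _ _ (dJ n yn) d1.
  der_eq; [der|rewrite /=].
  rewrite [in LHS](_ : 2 * pi * w * n.+1%:R * (y / n.+1%:R) = o * y).
    by move: (n.+1%:R) n0 => m n0; field.
  by rewrite /o; move: (n.+1%:R) n0 => m n0; field.
rewrite /cos_primitive; der_eq; [der|rewrite /=].
by move: o o0 => p p0; field; rewrite gt_eqF.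
Qed.

Lemma cos_primitive0 N : cos_primitive N 0 = 0.
Proof.
rewrite /cos_primitive mulr0 sin0 mulr0 mul0r add0r.
rewrite /dilate_sum /J_sum !big1 ?(mul0r, subrr)// => n _; rewrite mul0r.
  by rewrite J0 mul0r.
by rewrite a1_supp ?mul0r.
Qed.

(** For v >= 0 this is the integral of [a2] over [0, v] against the periodic kernel
    [cosker M (w * u)]. For v beyond B it agrees with the first M terms of [J_sum] at large y. *)
Definition J_partial M v : R := \sum_(n < M) J n v / n.+1%:R ^+ 2.

Lemma is_derive_J_partial M (v : R) : -1 < v ->
  is_derive v 1 (J_partial M) (a2 v * cosker M (w * v)).
Proof.
move=> v1; rewrite /cosker mulr_sumr.
apply: (@der1_sum _ v M (fun n v => J n v / n.+1%:R ^+ 2)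
  (fun n => a2 v * (cos (2 * pi * n.+1%:R * (w * v)) / n.+1%:R ^+ 2))) => n _.
have dJn := dJ n v1.
der_eq; [der|rewrite /=].
by rewrite mulr0 add0r [RHS]mulrA mulrC; congr (_ * cos _ / _); ring.
Qed.

(* Integration by parts against the Bernoulli polynomial (x - 1/2)^2 on a period. *)
Definition period_primitive k v : R :=
  pi ^+ 2 * (a1 v * (w * v - k - 2^-1) ^+ 2
    - 2 * w * a v * (w * v - k - 2^-1) + 2 * w ^+ 2 * Phi v).

Lemma is_derive_period_primitive k (v : R) : -1 < v ->
  is_derive v 1 (period_primitive k) (a2 v * (pi ^+ 2 * (w * v - k - 2^-1) ^+ 2)).
Proof.
move=> v1; have d0 := da v; have d1 := da1 v; have dP := dPhi v1.
by rewrite /period_primitive; der_eq; [der|rewrite /=; ring].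
Qed.

(** On this period, of length 1 / w, the combination has derivative
    [a2 v * cosker_error M (w * v - k%:R)]; the term in [a1] accounts for the normalisation of the
    error at 1/2. *)
Lemma period_error_le M k : (0 < M)%N ->
  `|(J_partial M (k.+1%:R / w) - cosker M 2^-1 * a1 (k.+1%:R / w)
      - period_primitive k%:R (k.+1%:R / w))
    - (J_partial M (k%:R / w) - cosker M 2^-1 * a1 (k%:R / w)
      - period_primitive k%:R (k%:R / w))| <= D * (2 / M%:R) / w.
Proof.
move=> M0; set u := k%:R / w; set v := k.+1%:R / w.
have uv : v - u = w^-1 by rewrite /u /v -natr1; field; rewrite gt_eqF.
have u0 : 0 <= u by rewrite divr_ge0// ltW.
have le_uv : u <= v by rewrite -subr_ge0 uv invr_ge0 ltW.
rewrite -uv.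
apply: (@norm_increment_le _
  (fun v => J_partial M v - cosker M 2^-1 * a1 v - period_primitive k%:R v)
  (fun v => a2 v * cosker_error M (w * v - k%:R)) u v _ le_uv) => x /andP[ux xv].
  have x1 : -1 < x by rewrite (lt_le_trans _ ux)// (lt_le_trans _ u0)//; lra.
  have d1 := is_derive_J_partial M x1; have d2 := da1 x.
  have d3 := is_derive_period_primitive k%:R x1.
  der_eq; [der|rewrite /= /cosker_error].
  rewrite -(cosker_periodic M k (w * x - k%:R)) subrK.
  move: (cosker M _) (cosker M _) (a1 x) (a2 x) => p q r s; ring.
rewrite normrM ler_pM// cosker_error_le//.
rewrite subr_gt0 ltrBlDl natr1 (mulrC w) -ltr_pdivrMr// -[X in _ && X]ltr_pdivlMr//.
by rewrite -/u ux.
Qed.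

Lemma poisson_sum M K : (0 < M)%N -> B < K%:R / w ->
  `|J_partial M (K%:R / w)
    - pi ^+ 2 * (2 * w ^+ 2 * (Phi (K%:R / w) - Phi 0)
                 - 2 * w * \sum_(n < K) a (n.+1%:R / w))|
  <= K%:R * (D * (2 / M%:R) / w).
Proof.
move=> M0 BK.
pose g v := J_partial M v - cosker M 2^-1 * a1 v
  - pi ^+ 2 * (a1 v / 4 + 2 * w ^+ 2 * Phi v).
(* At the two ends of the period, w v - k - 1/2 equals 1/2 and -1/2. The terms with the square and
   with [Phi] therefore telescope, through [g], while the linear terms add up to a trapezoidal sum
   of [a]. *)
have step k : (J_partial M (k.+1%:R / w) - cosker M 2^-1 * a1 (k.+1%:R / w)
      - period_primitive k%:R (k.+1%:R / w))
    - (J_partial M (k%:R / w) - cosker M 2^-1 * a1 (k%:R / w)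
      - period_primitive k%:R (k%:R / w)) =
    g (k.+1%:R / w) - g (k%:R / w) + pi ^+ 2 * w * (a (k.+1%:R / w) + a (k%:R / w)).
  rewrite /g /period_primitive !(mulrC w) !divfK ?gt_eqF// -natr1.
  move: (J_partial M _) (J_partial M _) (cosker M _) (a1 _) (a1 _) (a _) (a _) (Phi _) (Phi _).
  by move=> *; field.
(* The extreme values [a 0] and [a (K%:R / w)] vanish. *)
have tele : \sum_(k < K) (a (k.+1%:R / w) + a (k%:R / w)) = 2 * \sum_(n < K) a (n.+1%:R / w).
  rewrite big_split/= mulr_natl mulr2n; congr (_ + _).
  apply/(addIr (a (K%:R / w))); rewrite -(big_ord_recr K (fun k => a (k%:R / w)))/=.
  rewrite big_ord_recl/= mul0r a_supp ?supp0// add0r.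
  by rewrite [in RHS]a_supp ?gtB// addr0.
rewrite [X in `|X|](_ : _ = \sum_(k < K)
    (g (k.+1%:R / w) - g (k%:R / w) + pi ^+ 2 * w * (a (k.+1%:R / w) + a (k%:R / w)))).
  apply: le_trans (ler_norm_sum _ _ _) _; rewrite mulr_natl -[X in _ *+ X]card_ord.
  rewrite -sumr_const; apply: ler_sum => k _.
  by rewrite -step period_error_le.
rewrite big_split/= -mulr_sumr tele.
rewrite -(big_mkord xpredT (fun k => g (k.+1%:R / w) - g (k%:R / w))) telescope_sumr//.
rewrite /g mul0r !a1_supp ?supp0 ?gtB//.
rewrite [J_partial M 0]big1; last by move=> n _; rewrite J0 mul0r.
by ring.
Qed.

(** Four errors add up: the sine boundary term, at most e / o; the cosine boundary term; the part of
    [J_sum] past index M; and the error of [poisson_sum]. The last three are O(1 / M) for fixed K.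
    The limit is halved because only half of the line is integrated. *)
Lemma cos_primitive_approx M N K y e : (0 < M <= N)%N ->
  B < K%:R / w -> B * M%:R < y -> `|dilate_sum a 1 N y - C| <= e ->
  `|cos_primitive N y
    - (\sum_(n < K) a (n.+1%:R / w) / w - (Phi (K%:R / w) - Phi 0)) / 2|
  <= e / o + (D + D * B + K%:R * D * 2 / w) / o ^+ 2 / M%:R.
Proof.
move=> /andP[M0 MN] BK My le_e.
have M0' : 0 < M%:R :> R by rewrite ltr0n.
have By n : (n < M)%N -> B < y / n.+1%:R.
  move=> nM; rewrite ltr_pdivlMr ?ltr0n// (le_lt_trans _ My)// ler_pM2l//.
  by rewrite ler_nat.
have y0 : 0 <= y by rewrite ltW// (le_lt_trans _ My)// mulr_ge0// ltW.
have e1 : `|(dilate_sum a 1 N y - C) * sin (o * y) / o| <= e / o.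
  rewrite normrM [X in _ * X]gtr0_norm ?invr_gt0// ler_pM2r ?invr_gt0//.
  by rewrite normrM -[leRHS]mulr1 ler_pM// sin_max.
have e2 : `|dilate_sum a1 2 N y * cos (o * y) / o ^+ 2| <= D / M%:R / o ^+ 2.
  have o20 : 0 < o ^- 2 by rewrite invr_gt0 exprn_gt0.
  rewrite normrM [X in _ * X]gtr0_norm// ler_pM2r//.
  rewrite normrM -[leRHS]mulr1 ler_pM ?cos_max//.
  apply: dilate_sum_tail_le => //; first by rewrite M0.
  by move=> n nM; rewrite a1_supp// gtB// By.
have e3 : `|J_sum N y - J_partial M (K%:R / w)| <= D * B / M%:R.
  rewrite /J_sum /J_partial.
  rewrite -(big_mkord xpredT (fun n => J n (y / n.+1%:R) / n.+1%:R ^+ 2)).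
  rewrite -(big_mkord xpredT (fun n => J n (K%:R / w) / n.+1%:R ^+ 2)).
  rewrite (big_cat_nat (n := M))//= -addrA addrC -addrA [X in _ + X](_ : _ = 0).
    rewrite addr0; apply: (@le_trans _ _ (D * B * \sum_(M <= n < N) n.+1%:R ^- 2)).
      rewrite mulr_sumr; apply: le_trans (ler_norm_sum _ _ _) _; apply: ler_sum => n _.
      rewrite normrM [X in _ * X]ger0_norm ?invr_ge0 ?exprn_ge0// ler_wpM2r ?invr_ge0 ?exprn_ge0//.
      by rewrite J_le// divr_ge0.
    by rewrite ler_wpM2l ?sum_inv_sqr_le ?M0// mulr_ge0// ltW.
  (* The first M terms coincide: both arguments are beyond B, where [J n] is constant. *)
  rewrite addrC -sumrB big_nat big1// => n /andP[_ nM].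
  rewrite (J_const n (lexx B) (ltW (By _ nM))) (J_const n (lexx B) (ltW BK)) subrr//.
have e4 := poisson_sum M0 BK.
move: e1 e2 e3 e4; rewrite /cos_primitive.
set t1 := _ * sin _ / o; set t2 := _ * cos _ / _; set js := J_sum _ _; set jp := J_partial _ _.
set p := pi ^+ 2 * _ => e1 e2 e3 e4.
have -> : (\sum_(n < K) a (n.+1%:R / w) / w - (Phi (K%:R / w) - Phi 0)) / 2 = - p / o ^+ 2.
  rewrite -mulr_suml /p /o; have := gt_eqF (pi_gt0 R).
  by move: pi => q q0; field; rewrite q0 gt_eqF.
have -> : t1 + t2 - js / o ^+ 2 - - p / o ^+ 2 =
    t1 + (t2 + (- (js - jp) / o ^+ 2 + - (jp - p) / o ^+ 2)).
  by move: o o0 => q q0; field; rewrite gt_eqF.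
have div_le x b : `|x| <= b -> `|- x / o ^+ 2| <= b / o ^+ 2.
  have o20 : 0 < o ^- 2 by rewrite invr_gt0 exprn_gt0.
  by move=> xb; rewrite normrM normrN [X in _ * X]gtr0_norm// ler_pM2r.
have -> : e / o + (D + D * B + K%:R * D * 2 / w) / o ^+ 2 / M%:R =
    e / o + (D / M%:R / o ^+ 2 + (D * B / M%:R / o ^+ 2 +
      K%:R * (D * (2 / M%:R) / w) / o ^+ 2)).
  move: o o0 (M%:R) M0' => q q0 m m0; field; rewrite !gt_eqF//.
do !(apply: (le_trans (ler_normD _ _)); apply: lerD => //).
- exact: div_le.
- exact: div_le.
Qed.

End Frequency.

(** * Decay of the co-Poisson sum at infinity *)

Section LogPrimitive.
Context (Lam : R -> R) (dLam : forall x : R, 0 < x -> is_derive x 1 Lam (a x / x)).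

Lemma dilate_sum_stable N M y : `|y| < A * N%:R -> (N <= M)%N ->
  dilate_sum a 1 M y = dilate_sum a 1 N y.
Proof.
move=> yN NM.
rewrite /dilate_sum -!(big_mkord xpredT (fun n => a (y / n.+1%:R) / n.+1%:R ^+ 1)).
rewrite (big_cat_nat (n := N))//= [X in _ + X]big_nat [X in _ + X]big1 ?addr0// => n /andP[Nn _].
rewrite a_supp ?mul0r// negb_and -ltNge normrM normfV normr_nat.
rewrite ltr_pdivrMr ?ltr0n//.
by rewrite (lt_le_trans yN)// ler_pM2l// ler_nat leqW.
Qed.

Lemma Lam_const_above u v : B <= u -> u <= v -> Lam v = Lam u.
Proof.
move=> Bu uv; apply/eqP; rewrite -subr_eq0 -normr_le0 -(mul0r (v - u)).
apply: (@norm_increment_le _ _ (fun x => a x / x) u v _ uv) => x /andP[ux xv].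
  by apply: dLam; rewrite (lt_le_trans _ ux)// (lt_le_trans _ Bu).
by rewrite a_supp ?mul0r ?normr0// gtB// (le_lt_trans Bu).
Qed.

Lemma Lam_const_below u v : 0 < u -> u <= v -> v <= A -> Lam v = Lam u.
Proof.
move=> u0 uv vA; apply/eqP; rewrite -subr_eq0 -normr_le0 -(mul0r (v - u)).
apply: (@norm_increment_le _ _ (fun x => a x / x) u v _ uv) => x /andP[ux xv].
  by apply: dLam; rewrite (lt_le_trans _ ux).
rewrite a_supp ?mul0r ?normr0// negb_and -ltNge gtr0_norm ?(lt_trans u0)//.
by rewrite (lt_le_trans xv vA).
Qed.

(* For y > 0 the sum is a Riemann sum of mesh 1 / y of the smooth compactly
   supported function u |-> a (1 / u) / u, whose integral is that of a t / t. *)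
Lemma dilate_sum_decay N y : B < y -> y < A * N%:R ->
  `|dilate_sum a 1 N y - (Lam B - Lam A)| <=
    D * (B ^+ 5 + 4 * B ^+ 4 + 2 * B ^+ 3) / (2 * A) / y ^+ 2.
Proof.
move=> By yN.
have y0 : 0 < y by exact: lt_trans By.
(* Since y / (K + 1) < A, the terms from index K on vanish; K <= y / A will bound the number of
   subintervals. *)
pose K := (Num.truncn (y / A)).
have yA0 : 0 <= y / A by rewrite divr_ge0 ?ltW.
have yK : y < A * K.+1%:R by rewrite mulrC -ltr_pdivrMr// truncnS_gt.
have KN : (K < N)%N by rewrite truncn_lt_nat// ltr_pdivrMr// mulrC.
rewrite (@dilate_sum_stable K.+1 N)//; last by rewrite gtr0_norm.
set c := D * _.
pose g u := a u^-1 * u^-1.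
pose g1 u := - a1 u^-1 * u^-1 ^+ 3 - a u^-1 * u^-1 ^+ 2.
pose g2 u := a2 u^-1 * u^-1 ^+ 5 + 4 * a1 u^-1 * u^-1 ^+ 4 + 2 * a u^-1 * u^-1 ^+ 3.
have dV (u : R) : 0 < u -> is_derive u 1 (fun u => u^-1) (- u ^- 2).
  move=> u0; apply: (der1_congr (@der1_inv R u id 1 _ (der1_id u))) => /=.
    by rewrite gt_eqF.
  by rewrite mulr1.
have dg (u : R) : 0 < u -> is_derive u 1 g (g1 u).
  move=> u0; have d0 := dV u u0.
  have d1 := @der1_comp _ u (fun u => u^-1) a _ _ (da _) d0.
  by rewrite /g; der_eq; [der|rewrite /= /g1; field; rewrite gt_eqF].
have dg1 (u : R) : 0 < u -> is_derive u 1 g1 (g2 u).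
  move=> u0; have d0 := dV u u0.
  have d1 := @der1_comp _ u (fun u => u^-1) a _ _ (da _) d0.
  have d2 := @der1_comp _ u (fun u => u^-1) a1 _ _ (da1 _) d0.
  by rewrite /g1; der_eq; [der|rewrite /= /g2; field; rewrite gt_eqF].
have dPsi (u : R) : 0 < u -> is_derive u 1 (fun u => - Lam u^-1) (g u).
  move=> u0; have d0 := dV u u0.
  have v0 : 0 < u^-1 by rewrite invr_gt0.
  have d1 := @der1_comp _ u (fun u => u^-1) Lam _ _ (dLam v0) d0.
  by der_eq; [der|rewrite /= /g; field; rewrite gt_eqF].
(* If 1 / u > B every term vanishes; otherwise powers of 1 / u are at most those of B, whence the
   constant. *)
have g2c (u : R) : 0 < u -> `|g2 u| <= c.
  move=> u0; rewrite /g2; set v := u^-1.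
  have v0 : 0 < v by rewrite invr_gt0.
  have [vB|Bv] := leP v B; last first.
    rewrite a_supp ?a1_supp ?a2_supp ?gtB// !(mulr0, mul0r, addr0) normr0.
    have pB m : 0 <= B ^+ m by rewrite exprn_ge0// ltW.
    by apply: mulr_ge0 => //; do !apply: addr_ge0 => //; apply: mulr_ge0.
  have le_pow m : `|v ^+ m| <= B ^+ m.
    by rewrite ger0_norm ?exprn_ge0 ?(ltW v0)// lerXn2r// nnegrE ltW.
  rewrite /c !mulrDr -!addrA; apply: (le_trans (ler_normD _ _)); apply: lerD.
    by rewrite normrM ler_pM.
  apply: (le_trans (ler_normD _ _)); apply: lerD.
    by rewrite 2!normrM (ger0_norm (ler0n _ _)) -mulrA [leRHS]mulrCA ler_pM2l//; apply: ler_pM.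
  by rewrite 2!normrM (ger0_norm (ler0n _ _)) -mulrA [leRHS]mulrCA ler_pM2l//; apply: ler_pM.
(* The terms of index 0 and K vanish, so the Riemann sum is also the trapezoidal sum on the nodes 1
   / y, ..., (K + 1) / y. *)
have sK : dilate_sum a 1 K.+1 y = \sum_(k < K)
    (y^-1 * (g (k.+1%:R / y) + g (k.+2%:R / y)) / 2).
  have gE k : y^-1 * g (k.+1%:R / y) = a (y / k.+1%:R) / k.+1%:R ^+ 1.
    have := ltr0Sn R k; move: (k.+1%:R) => m m0.
    by rewrite /g invf_div; field; rewrite !gt_eqF.
  under eq_bigr do rewrite mulrDr !gE mulrDl.
  rewrite big_split/= -!mulr_suml /dilate_sum.
  pose t k := a (y / k.+1%:R) / k.+1%:R ^+ 1.
  have t0 : t 0%N = 0 by rewrite /t expr1 !divr1 a_supp ?gtB.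
  have tK : t K = 0.
    rewrite /t a_supp ?mul0r// negb_and -ltNge gtr0_norm ?divr_gt0//.
    by rewrite ltr_pdivrMr ?yK.
  rewrite (_ : \sum_(i < K) _ = dilate_sum a 1 K.+1 y); last first.
    by rewrite /dilate_sum big_ord_recr/= -[X in _ = _ + X]/(t K) tK addr0.
  rewrite (_ : \sum_(i < K) _ = dilate_sum a 1 K.+1 y); last first.
    rewrite /dilate_sum big_ord_recl/= -[X in _ = X + _]/(t 0%N) t0 add0r.
    by apply: eq_bigr => k _; rewrite /bump/= add1n.
  by rewrite -/(dilate_sum a 1 K.+1 y); field.
(* The sum telescopes to Lam (y) - Lam (y / (K + 1)), and [Lam] is constant beyond B and on ]0,
   A]. *)
have sPsi : Lam B - Lam A = \sum_(k < K) (- Lam (k.+2%:R / y)^-1 - - Lam (k.+1%:R / y)^-1).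
  rewrite -(big_mkord xpredT (fun k => - Lam (k.+2%:R / y)^-1 - - Lam (k.+1%:R / y)^-1)).
  rewrite telescope_sumr// !invf_div divr1 (@Lam_const_above B y)// ?ltW//.
  rewrite (@Lam_const_below (y / K.+1%:R) A) ?divr_gt0//; first by ring.
  by rewrite ler_pdivrMr// ltW.
rewrite sK sPsi -sumrB.
apply: le_trans (ler_norm_sum _ _ _) _.
apply: (@le_trans _ _ (\sum_(k < K) (c * y^-1 ^+ 3 / 2))); last first.
  rewrite sumr_const card_ord -[X in X <= _]mulr_natl.
  have -> : c / (2 * A) / y ^+ 2 = (y / A) * (c * y^-1 ^+ 3 / 2).
    by field; rewrite !gt_eqF.
  rewrite ler_wpM2r ?truncn_le//.
  have c0 : 0 <= c by apply: le_trans (g2c 1 _).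
  by rewrite divr_ge0// mulr_ge0// exprn_ge0// invr_ge0 ltW.
apply: ler_sum => k _.
have step : k.+2%:R / y - k.+1%:R / y = y^-1.
  by rewrite -natr1; field; rewrite gt_eqF.
have pos x : k.+1%:R / y <= x -> 0 < x by apply: lt_le_trans; rewrite divr_gt0.
have := @trapezoid_error_le R g g1 g2 (fun u => - Lam u^-1)
  (k.+1%:R / y) (k.+2%:R / y) c; rewrite step; apply.
- by rewrite -subr_ge0 step invr_ge0 ltW.
- by move=> x /andP[/pos x0 _]; exact: dg.
- by move=> x /andP[/pos x0 _]; exact: dg1.
- by move=> x /andP[/pos x0 _]; exact: dPsi.
- by move=> x /andP[/pos x0 _]; exact: g2c.
Qed.

End LogPrimitive.

(** * Integrability and Fourier integrals of the co-Poisson sum *)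

Let C : R := \int[mu]_(t in `]0, +oo[) (a t / t).
Let P := real_coPoisson a.

(** The later terms have arguments of modulus below A. One N serves a whole neighbourhood, or a
    whole segment [0, k], so that P can be differentiated there as a finite sum. *)
Lemma real_coPoissonE N (y : R) : `|y| < A * N%:R -> P y = dilate_sum a 1 N y - C.
Proof.
move=> yN; rewrite /P /real_coPoisson (@limn_series_finite _ _ N)// => n Nn.
rewrite a_supp ?mul0r// negb_and -ltNge normrM normfV normr_nat.
by rewrite ltr_pdivrMr ?ltr0n// (lt_le_trans yN)// ler_pM2l// ler_nat leqW.
Qed.

Let exists_bound (y : R) : exists N, `|y| < A * N%:R.
Proof.
exists (Num.truncn (`|y| / A)).+1.
by rewrite mulrC -ltr_pdivrMr// truncnS_gt.
Qed.

Let a_continuous : continuous a.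
Proof. by move=> x; exact: is_derive_continuous (da x). Qed.

(** At 0 the quotient takes the default value 0, which agrees with the vanishing of [a] near 0. *)
Lemma quotient_continuous : continuous (fun x => a x / x).
Proof.
move=> x; have [->|x0] := eqVneq x 0; last first.
  by apply: cvgM; [exact: a_continuous|apply: cvgV].
rewrite /continuous_at/= invr0 mulr0.
apply: cvg_near_cst; have := @nbhsx_ballx _ _ (0 : R) _ A0.
apply: filterS => y; rewrite /ball/= sub0r normrN => yA.
by rewrite a_supp ?mul0r// negb_and -ltNge yA.
Qed.

Lemma exists_log_primitive : exists2 Lam : R -> R,
  forall x : R, 0 < x -> is_derive x 1 Lam (a x / x) & C = Lam B - Lam A.
Proof.
have [Lam dL] := primitive_right 0 quotient_continuous.
exists Lam; first exact: dL.
apply: Rintegral_0y_primitive => //.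
- move=> x x0 xAB; rewrite a_supp ?mul0r// gtr0_norm//.
- exact: continuous_subspaceT quotient_continuous.
- by move=> x /andP[Ax _]; apply: dL; exact: lt_le_trans Ax.
Qed.

Let c := D * (B ^+ 5 + 4 * B ^+ 4 + 2 * B ^+ 3) / (2 * A).

Lemma real_coPoisson_decay y : B < y -> `|P y| <= c / y ^+ 2.
Proof.
move=> By; have [Lam dL CE] := exists_log_primitive.
have [N yN] := exists_bound y; rewrite (real_coPoissonE yN) CE.
by apply: dilate_sum_decay => //; apply: le_lt_trans yN; exact: ler_norm.
Qed.

Lemma real_coPoisson_even y : P (- y) = P y.
Proof. exact: real_coPoissonN. Qed.

Lemma real_coPoisson_continuous : continuous P.
Proof.
move=> y; have [N yN] := exists_bound y.
have yN0 : 0 < A * N%:R - `|y| by rewrite subr_gt0.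
have nearE : \forall z \near y, P z = dilate_sum a 1 N z - C.
  have := @nbhsx_ballx _ _ y _ yN0.
  apply: filterS => z; rewrite /ball/= => yz; apply: real_coPoissonE.
  rewrite -(subrK y z) addrC (le_lt_trans (ler_normD _ _))// -ltrBrDl distrC//.
rewrite /continuous_at (nbhs_singleton nearE).
have ds := @is_derive_dilate_sum a a1 1 N y (fun n => da _).
have cs : {for y, continuous (fun z => dilate_sum a 1 N z - C)}.
  by apply: is_derive_continuous; der.
apply: cvg_trans cs; apply: near_eq_cvg.
by apply: filterS nearE => z ->.
Qed.

Lemma real_coPoisson_le : exists K, forall y, `|P y| <= K * (oneDsqr y)^-1.
Proof.
have [N BN] := exists_bound (B + 1).
have B1 : 0 < B + 1 by rewrite addr_gt0.
rewrite gtr0_norm// in BN.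
have c0 : 0 <= c.
  have pB m : 0 <= B ^+ m by rewrite exprn_ge0// ltW.
  apply: divr_ge0; last by rewrite mulr_ge0// ltW.
  by apply: mulr_ge0 => //; do !apply: addr_ge0 => //; apply: mulr_ge0.
have E0 : 0 <= (N%:R * D + `|C|) * oneDsqr (B + 1).
  apply: mulr_ge0; first by rewrite addr_ge0 ?mulr_ge0.
  by rewrite (le_trans ler01)// oneDsqr_ge1.
(* The first summand serves for |y| <= B + 1, where N terms of size at most D occur; the second for
   larger |y|, where 1 + y^2 <= 2 y^2 and the decay applies. *)
exists ((N%:R * D + `|C|) * oneDsqr (B + 1) + 2 * c) => y.
have p0 : 0 < oneDsqr y by rewrite (lt_le_trans ltr01)// oneDsqr_ge1.
rewrite ler_pdivlMr//; have [yB|By] := leP `|y| (B + 1).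
  rewrite -[leLHS]addr0; apply: lerD; last by rewrite mulr_ge0.
  apply: ler_pM => //.
    rewrite (@real_coPoissonE N) ?(le_lt_trans yB)// (le_trans (ler_normB _ _))//.
    rewrite lerD2r /dilate_sum (le_trans (ler_norm_sum _ _ _))//.
    rewrite mulr_natl -[X in _ *+ X]card_ord -sumr_const; apply: ler_sum => n _.
    rewrite normrM -[leRHS]mulr1 ler_pM//.
    by rewrite expr1 normfV normr_nat invf_le1 ?ltr0n// ler1n.
  by rewrite /oneDsqr lerD2l -real_normK ?num_real// lerXn2r// nnegrE ltW.
have PE : P y = P `|y|.
  by case: (leP 0 y) => y0; [rewrite ger0_norm|rewrite ltr0_norm ?real_coPoisson_even].
have y1 : 1 <= `|y| by rewrite (le_trans _ (ltW By))// lerDr ltW.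
have By' : B < `|y| by rewrite (le_lt_trans _ By)// lerDl.
rewrite PE -[leLHS]add0r; apply: lerD => //.
have y20 : 0 < `|y| ^+ 2 by rewrite exprn_gt0// (lt_le_trans ltr01).
apply: (@le_trans _ _ (c / `|y| ^+ 2 * (2 * `|y| ^+ 2))).
  apply: ler_pM; rewrite ?(ltW p0) ?real_coPoisson_decay//.
  rewrite /oneDsqr -(real_normK (num_real y)) mulr_natl mulr2n lerD2r.
  by rewrite exprn_ege1.
by rewrite [X in _ * X]mulrC mulrA divfK ?gt_eqF// mulrC.
Qed.

Lemma real_coPoisson_integrable : mu.-integrable setT (EFin \o P).
Proof.
have [K PK] := real_coPoisson_le.
apply: (@le_integrable _ _ R mu setT measurableT _
  (fun x => K%:E * (EFin \o (fun x : R => (oneDsqr x)^-1)%R) x)%E).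
- by apply/measurable_EFinP; apply: continuous_measurable_fun; exact: real_coPoisson_continuous.
- by move=> y _; rewrite lee_fin/= (le_trans (PK y))// ler_norm.
- exact/integrableZl/integrable_oneDsqrV.
Qed.

Lemma primitive_const_above (Phi : R -> R) u v :
  (forall x : R, -1 < x -> is_derive x 1 Phi (a x)) ->
  B <= u -> u <= v -> Phi v = Phi u.
Proof.
move=> dPhi Bu uv; apply/eqP; rewrite -subr_eq0 -normr_le0 -(mul0r (v - u)).
apply: (@norm_increment_le _ Phi a u v _ uv) => x /andP[ux xv].
  by apply: dPhi; rewrite (lt_le_trans _ ux)// (lt_le_trans _ Bu)// (lt_trans _ B0)//; lra.
by rewrite a_supp ?normr0// gtB// (le_lt_trans Bu).
Qed.

Lemma primitive_const_below (Phi : R -> R) : (forall x : R, -1 < x -> is_derive x 1 Phi (a x)) ->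
  Phi A = Phi 0.
Proof.
move=> dPhi; apply/eqP; rewrite -subr_eq0 -normr_le0 -[leRHS](mul0r (A - 0)).
apply: (@norm_increment_le _ Phi a 0 A _ (ltW A0)) => x /andP[x0 xA].
  by apply: dPhi; rewrite (lt_le_trans _ x0)//; lra.
by rewrite a_supp ?normr0// negb_and -ltNge gtr0_norm ?xA.
Qed.

(** The points n / w with n > K lie beyond B, so K terms remain. The map t -> 1 / t turns the
    subtracted integral into that of [a], and [Phi] agrees at 0 and A, and at B and K / w. *)
Lemma real_coPoisson_inversion (Phi : R -> R) w K :
  (forall x : R, -1 < x -> is_derive x 1 Phi (a x)) ->
  0 < w -> B < K%:R / w ->
  real_coPoisson (real_inversion a) w =
  \sum_(n < K) a (n.+1%:R / w) / w - (Phi (K%:R / w) - Phi 0).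
Proof.
move=> dPhi w0 BK; rewrite /real_coPoisson; congr (_ - _).
  rewrite (@limn_series_finite _ _ K) => [|n Kn].
    apply: eq_bigr => n _; rewrite /real_inversion mulf_eq0 invr_eq0 pnatr_eq0 gt_eqF//=.
    have := ltr0Sn R n; move: (n.+1%:R) => m m0.
    by rewrite invf_div gtr0_norm ?divr_gt0//; field; rewrite !gt_eqF.
  rewrite /real_inversion mulf_eq0 invr_eq0 pnatr_eq0 gt_eqF//= invf_div.
  rewrite a_supp ?mul0r// gtB// (lt_le_trans BK)// ler_pM2r ?invr_gt0//.
  by rewrite ler_nat leqW.
rewrite (primitive_const_above dPhi (lexx B) (ltW BK)) -(primitive_const_below dPhi).
have dF (x : R) : 0 < x -> is_derive x 1 (fun x => - Phi x^-1) (a x^-1 / x / x).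
  move=> x0; have d0 := der1_inv (negbT (gt_eqF x0)) (der1_id x).
  have v0 : -1 < x^-1 by rewrite (@lt_trans _ _ 0) ?invr_gt0.
  have d1 := @der1_comp _ x (fun x => x^-1) Phi _ _ (dPhi _ v0) d0.
  by der_eq; [der|rewrite /=; field; rewrite gt_eqF].
have iAB : B^-1 < A^-1 by rewrite ltf_pV2.
rewrite (_ : \int[mu]_(t in `]0, +oo[) _ =
    \int[mu]_(t in `]0, +oo[) (a t^-1 / t / t)); last first.
  apply: eq_Rintegral => t; rewrite inE/= in_itv/= andbT => t0.
  by rewrite /real_inversion gt_eqF// gtr0_norm.
transitivity (- Phi A^-1^-1 - - Phi B^-1^-1); last by rewrite !invrK opprK addrC.
apply: (@Rintegral_0y_primitive _ _ (fun x => - Phi x^-1) B^-1 A^-1) => //.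
- by rewrite invr_gt0.
- move=> x x0 xAB; rewrite a_supp ?mul0r// gtr0_norm ?invr_gt0//.
  by rewrite -(invrK A) -(invrK B) !lef_pV2 ?posrE ?invr_gt0// andbC.
- apply: derivable_within_continuous => x; rewrite in_itv/= => /andP[Bx _].
  have x0 : 0 < x by rewrite (lt_le_trans _ Bx) ?invr_gt0.
  have d0 := der1_inv (negbT (gt_eqF x0)) (der1_id x).
  have d1 := @der1_comp _ x (fun x => x^-1) a _ _ (da _) d0.
  have [l] : exists l, is_derive x 1 (fun x => a x^-1 / x / x) l by eexists; der.
  by case.
- by move=> x /andP[Bx _]; apply: dF; rewrite (lt_le_trans _ Bx) ?invr_gt0.
Qed.

(** The integral is the limit over [-k, k], where it is twice the value of [cos_primitive] at k. M
    is chosen from e, then k large in terms of M, then N from k and M. *)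
Lemma cos_integral_pos (w : R) : 0 < w ->
  \int[mu]_y (P y * cos (2 * pi * w * y)) = real_coPoisson (real_inversion a) w.
Proof.
move=> w0; pose o := 2 * pi * w.
have o0 : 0 < o by rewrite !mulr_gt0// pi_gt0.
have [Phi dPhi] := primitive_right (-1) a_continuous.
have /boolp.choice[J hJ] : forall n, exists G : R -> R, G 0 = 0 /\ forall v : R, -1 < v ->
    is_derive v 1 G (a2 v * cos (2 * pi * w * n.+1%:R * v)).
  move=> n.
  have [G dG] : exists G : R -> R, forall v : R, -1 < v ->
      is_derive v 1 G (a2 v * cos (2 * pi * w * n.+1%:R * v)).
    apply: primitive_right => v; apply: cvgM; [exact: a2_continuous|exact: cosM_continuous].
  exists (fun v => G v - G 0); split=> [|v v1]; first by rewrite subrr.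
  by have d0 := dG v v1; der_eq; [der|rewrite addr0].
have J0 n : J n 0 = 0 by have [] := hJ n.
have dJ n (v : R) : -1 < v -> is_derive v 1 (J n) (a2 v * cos (2 * pi * w * n.+1%:R * v)).
  by have [_] := hJ n; exact.
pose K := (Num.truncn (B * w)).+1.
have BK : B < K%:R / w by rewrite ltr_pdivlMr// truncnS_gt.
rewrite (real_coPoisson_inversion dPhi w0 BK); set V := _ - _.
have P_cos := integrable_mul_bounded real_coPoisson_integrable
  (cosM_continuous (b := o)) (fun y => cos_max _).
apply: (cvg_unique _ (Rintegral_symm_segment_cvg P_cos)) => //.
apply/cvgrPdist_le => e e0.
(* Half of e is available before doubling: a quarter for Q / M, a quarter for the sine boundary
   term. *)
pose Q := (D + D * B + K%:R * D * 2 / w) / o ^+ 2.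
pose M := (Num.truncn (4 * `|Q| / e)).+1.
have QM : Q / M%:R <= e / 4.
  rewrite ler_pdivrMr ?ltr0n// -ler_pdivrMl ?divr_gt0// invf_div.
  apply: (@le_trans _ _ (4 * `|Q| / e)); last exact/ltW/truncnS_gt.
  by rewrite [leRHS]mulrAC ler_wpM2l ?ler_norm// divr_ge0// ltW.
near=> k.
have k1 : (1 : R) <= k%:R by near: k; exact: nbhs_infty_ger.
have k0 : (0 : R) < k%:R by exact: lt_le_trans k1.
have Bk : B < k%:R by near: k; exact: nbhs_infty_gtr.
have BMk : B * M%:R < k%:R by near: k; exact: nbhs_infty_gtr.
(* As k >= 1, this also bounds k^2 from below, as the decay rate c / k^2 requires. *)
have ck : 4 * c / (o * e) <= k%:R by near: k; exact: nbhs_infty_ger.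
have [N0 kN0] := exists_bound k%:R; pose N := maxn N0 M.
have kN : `|k%:R : R| < A * N%:R.
  by rewrite (lt_le_trans kN0)// ler_pM2l// ler_nat leq_maxl.
have -> : \int[mu]_(x in `[- k%:R, k%:R]) (P x * cos (o * x)) =
    2 * (cos_primitive w C J N k%:R - cos_primitive w C J N 0).
  apply: Rintegral_even_primitive => //.
  - by move=> y; apply: cvgM; [exact: real_coPoisson_continuous|exact: cosM_continuous].
  - by move=> y; rewrite real_coPoisson_even mulrN cosN.
  - move=> x /andP[x0 xk]; rewrite (@real_coPoissonE N); last first.
      by rewrite ger0_norm// (le_lt_trans xk)// (le_lt_trans (ler_norm _)).
    apply: (is_derive_cos_primitive C w0 dJ).
    by rewrite (lt_le_trans _ x0)//; lra.
rewrite (cos_primitive0 w C J0) subr0.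
have MN : (0 < M <= N)%N by rewrite leq_maxr.
have decay : `|dilate_sum a 1 N k%:R - C| <= c / k%:R ^+ 2.
  by rewrite -real_coPoissonE// real_coPoisson_decay.
have := cos_primitive_approx w0 J0 dJ dPhi MN BK BMk decay.
rewrite -/V -/o -/Q => approx.
have -> : V - 2 * cos_primitive w C J N k%:R =
    - (2 * (cos_primitive w C J N k%:R - V / 2)) by field.
rewrite normrN normrM ger0_norm// -ler_pdivlMl// (le_trans approx)//.
rewrite [leRHS](_ : _ = e / 4 + e / 4); last by field.
apply: lerD => //.
move: ck; rewrite ler_pdivrMr ?(mulr_gt0 o0 e0)// => ck.
rewrite ler_pdivrMr// ler_pdivrMr ?exprn_gt0//.
rewrite -(ler_pM2l (_ : 0 < 4 :> R))// (le_trans ck)//.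
rewrite -[leLHS]mulr1 [leRHS](_ : _ = k%:R * (o * e) * k%:R); last by field.
by rewrite ler_wpM2l// mulr_ge0// ltW// (mulr_gt0 o0 e0).
Unshelve. all: by end_near. Qed.

Lemma real_inversion_even y : real_inversion a (- y) = real_inversion a y.
Proof. by rewrite /real_inversion oppr_eq0 invrN a_even normrN. Qed.

(** For 0 < w < 1 / B all points n / w lie beyond B, so every term vanishes, as it does at w = 0 by
    the convention I(a)(0) = 0. *)
Lemma real_coPoisson_inversion_near0 (w : R) : 0 <= w -> B * w < 1 ->
  real_coPoisson (real_inversion a) w = real_coPoisson (real_inversion a) 0.
Proof.
move=> w0 Bw; rewrite /real_coPoisson; congr (limn (series _) - _).
apply/funext => n; rewrite mul0r /real_inversion eqxx; case: eqVneq => // wn.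
have {wn} wn : 0 < w.
  by rewrite lt0r w0 andbT; apply: contraNneq wn => ->; rewrite mul0r.
rewrite a_supp ?mul0r// gtB// invf_div ltr_pdivlMr// (lt_le_trans Bw)//.
by rewrite ler1n.
Qed.

Lemma cos_integral (w : R) :
  \int[mu]_y (P y * cos (2 * pi * w * y)) = real_coPoisson (real_inversion a) w.
Proof.
have [w0|w0|<-] := ltgtP 0 w; first exact: cos_integral_pos.
  rewrite -[w]opprK (real_coPoissonN _ real_inversion_even) -cos_integral_pos ?oppr_gt0//.
  by apply: eq_Rintegral => y _; rewrite mulrN mulNr cosN.
(* The value at 0 is the limit along the frequencies 1 / (n + 1): the integrals converge by
   domination, and the right-hand side is eventually constant. *)
pose u n : R := n.+1%:R^-1.
have u0 : u n @[n --> \oo] --> (0 : R) by exact: cvg_harmonic.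
have lim_int : \int[mu]_y (P y * cos (2 * pi * u n * y)) @[n --> \oo] -->
    \int[mu]_y (P y * cos (2 * pi * 0 * y)).
  apply: (@Rintegral_dominated_cvg _ _ _ (fun y => `|P y|)).
  - move=> n; apply: continuous_measurable_fun => y.
    by apply: cvgM; [exact: real_coPoisson_continuous|exact: cosM_continuous].
  - apply: continuous_measurable_fun => y.
    by apply: cvgM; [exact: real_coPoisson_continuous|exact: cosM_continuous].
  - move=> y; apply: cvgM; first exact: cvg_cst.
    have cu : 2 * pi * u n * y @[n --> \oo] --> 2 * pi * 0 * y.
      by apply: cvgM; [apply: cvgM => //; exact: cvg_cst|exact: cvg_cst].
    exact: (cvg_comp _ _ cu (@continuous_cos R _)).
  - exact: integrable_norm real_coPoisson_integrable.
  - by move=> n y; rewrite normrM -[leRHS]mulr1 ler_wpM2l// cos_max.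
apply: (cvg_unique _ lim_int) => //; apply: cvg_near_cst; near=> n.
have un : 0 < u n by rewrite invr_gt0.
rewrite cos_integral_pos// real_coPoisson_inversion_near0//; first exact: ltW.
rewrite ltr_pdivrMr// mul1r -natr1 ltr_wpDr//.
by near: n; exact: nbhs_infty_gtr.
Unshelve. all: by end_near. Qed.

(** P is even, so the integrand is odd and its integrals over [-k, k] vanish. *)
Lemma sin_integral (w : R) : \int[mu]_y (P y * sin (2 * pi * w * y)) = 0.
Proof.
have P_sin := integrable_mul_bounded real_coPoisson_integrable
  (sinM_continuous (b := 2 * pi * w)) (fun y => sin_max _).
apply: (cvg_unique _ (Rintegral_symm_segment_cvg P_sin)) => //.
apply: cvg_near_cst; near=> k; apply: Rintegral_odd.
- by near: k; exact: nbhs_infty_gtr.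
- by move=> y; apply: cvgM; [exact: real_coPoisson_continuous|exact: sinM_continuous].
- by move=> y; rewrite real_coPoisson_even !mulrN sinN mulrN.
Unshelve. all: by end_near. Qed.

End Bump.

(** * Real and imaginary parts *)

Section SmoothBump.
Context {R : realType} (f : R -> R) (A B : R).
Context (f_smooth : rsmooth f) (f_even : forall x, f (- x) = f x)
  (A0 : 0 < A) (AB : A < B)
  (f_supp : forall x : R, ~~ (A <= `|x| <= B) -> f x = 0).
Local Notation mu := (@lebesgue_measure R).

Let is_derive_derive1n n (x : R) : is_derive x 1 (derive1n n f) (derive1n n.+1 f x).
Proof. by rewrite derive1nS derive1E; apply/derivableP; exact: f_smooth. Qed.

Let derive1n_continuous n : continuous (derive1n n f).
Proof. by move=> x; exact: is_derive_continuous (is_derive_derive1n n x). Qed.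

(** The complement of the annulus is open, so the preceding derivative vanishes on a neighbourhood
    of x. *)
Lemma derive1n_supp n (x : R) : ~~ (A <= `|x| <= B) -> derive1n n f x = 0.
Proof.
elim: n x => [//|n IH] x xAB.
have near0 : \forall y \near x, derive1n n f y = 0.
  have : \forall y \near x, ~~ (A <= `|y| <= B).
    have norm_x : `|y| @[y --> x] --> `|x| by exact: norm_continuous.
    move: xAB; rewrite negb_and -!ltNge => /orP[xA|Bx].
      by near=> y; rewrite negb_and -!ltNge; apply/orP; left; near: y; exact: cvgr_lt xA.
    by near=> y; rewrite negb_and -!ltNge; apply/orP; right; near: y; exact: cvgr_gt Bx.
  by apply: filterS => y; exact: IH.
have d0 : is_derive x 1 (derive1n n f) 0.
  have cst0 : is_derive x 1 (cst (0 : R)) (0 : R) by exact: is_derive_cst.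
  by apply: near_eq_is_derive cst0; apply: filterS near0 => y ->.
by have := is_derive_derive1n n x; move=> [_ <-]; case: d0.
Unshelve. all: by end_near. Qed.

Lemma derive1n_bounded n : exists D, forall x, `|derive1n n f x| <= D.
Proof.
have [||c _ cmax] := @EVT_max R (fun x => `|derive1n n f x|) (- B) B.
- by rewrite (@le_trans _ _ 0)// ?oppr_le0 ltW// (lt_trans A0).
- apply: continuous_subspaceT => x.
  by apply: continuous_comp; [exact: derive1n_continuous|exact: norm_continuous].
exists `|derive1n n f c| => x.
have [xAB|xAB] := boolP (A <= `|x| <= B); last by rewrite derive1n_supp// normr0.
by apply: cmax; rewrite in_itv/= -ler_norml; case/andP: xAB.
Qed.

Lemma real_coPoisson_fourier :
  [/\ mu.-integrable setT (EFin \o real_coPoisson f),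
      forall w, \int[mu]_y (real_coPoisson f y * cos (2 * pi * w * y)) =
        real_coPoisson (real_inversion f) w &
      forall w, \int[mu]_y (real_coPoisson f y * sin (2 * pi * w * y)) = 0].
Proof.
have [D0 le0] := derive1n_bounded 0; have [D1 le1] := derive1n_bounded 1.
have [D2 le2] := derive1n_bounded 2.
pose D := Num.max D0 (Num.max D1 D2).
have {}le0 x : `|f x| <= D by rewrite le_max le0.
have {}le1 x : `|derive1n 1 f x| <= D by rewrite !le_max le1 orbT.
have {}le2 x : `|derive1n 2 f x| <= D by rewrite !le_max le2 !orbT.
have d0 := is_derive_derive1n 0; have d1 := is_derive_derive1n 1.
have c2 := derive1n_continuous (n := 2).
have s1 := @derive1n_supp 1; have s2 := @derive1n_supp 2.
split.
- exact: (real_coPoisson_integrable A0 AB d0 d1 f_supp s1 s2 le0 le1 le2 f_even).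
- exact: (cos_integral A0 AB d0 d1 c2 f_supp s1 s2 le0 le1 le2 f_even).
- exact: (sin_integral A0 AB d0 d1 f_supp s1 s2 le0 le1 le2 f_even).
Qed.

End SmoothBump.

(** * Reduction of the complex statement to the real one *)

Section ComplexParts.
Context {R : realType}.
Implicit Types (alpha : R -> R[i]) (z : R[i]) (r : R).

Lemma Re_div_real z r : complex.Re (z / r%:C) = complex.Re z / r.
Proof.
by rewrite -fmorphV; case: z => p q /=; rewrite mulr0 subr0.
Qed.

Lemma Im_div_real z r : complex.Im (z / r%:C) = complex.Im z / r.
Proof.
by rewrite -fmorphV; case: z => p q /=; rewrite mulr0 add0r.
Qed.

Lemma Re_coPoisson alpha y :
  complex.Re (coPoisson alpha y) = real_coPoisson (fun x => complex.Re (alpha x)) y.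
Proof.
rewrite /coPoisson /cseries /cintegral /real_coPoisson /=; congr (limn (series _) - _).
  by apply/funext => n; rewrite -(rmorph_nat (real_complex R)) Re_div_real.
by apply: eq_Rintegral => t _; rewrite Re_div_real.
Qed.

Lemma Im_coPoisson alpha y :
  complex.Im (coPoisson alpha y) = real_coPoisson (fun x => complex.Im (alpha x)) y.
Proof.
rewrite /coPoisson /cseries /cintegral /real_coPoisson /=; congr (limn (series _) - _).
  by apply/funext => n; rewrite -(rmorph_nat (real_complex R)) Im_div_real.
by apply: eq_Rintegral => t _; rewrite Im_div_real.
Qed.

Lemma Re_fourier alpha w : complex.Re (fourier alpha w) =
  \int[lebesgue_measure]_y (complex.Re (alpha y) * cos (2 * pi * w * y)
                             - complex.Im (alpha y) * sin (2 * pi * w * y)).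
Proof. by apply: eq_Rintegral => y _; case: (alpha y). Qed.

Lemma Im_fourier alpha w : complex.Im (fourier alpha w) =
  \int[lebesgue_measure]_y (complex.Im (alpha y) * cos (2 * pi * w * y)
                             + complex.Re (alpha y) * sin (2 * pi * w * y)).
Proof. by apply: eq_Rintegral => y _; case: (alpha y) => p q; rewrite addrC. Qed.

Lemma Re_inversion alpha y :
  complex.Re (inversion alpha y) = real_inversion (fun x => complex.Re (alpha x)) y.
Proof. by rewrite /inversion /real_inversion; case: ifP => // _; rewrite Re_div_real. Qed.

Lemma Im_inversion alpha y :
  complex.Im (inversion alpha y) = real_inversion (fun x => complex.Im (alpha x)) y.
Proof. by rewrite /inversion /real_inversion; case: ifP => // _; rewrite Im_div_real. Qed.

(** [A] is the radius of a ball around 0 that misses the closed support; [B] exceeds a bound of the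
    compact support, with [A] added to secure [A < B]. *)
Lemma compact_support_away0_annulus alpha : compact_support_away0 alpha ->
  exists A B, [/\ 0 < A, A < B & forall x, ~~ (A <= `|x| <= B) -> alpha x = 0].
Proof.
move=> [cS S0].
have [M [_ hM]] := compact_bounded cS.
have [A A0 hA] : exists2 A : R, 0 < A & forall x : R, `|x| < A -> alpha x = 0.
  have [A A0 hA] : exists2 A : R, 0 < A & forall x : R, ball 0 A x -> alpha x = 0.
    apply: contrapT => hN; apply: S0 => U /nbhs_ballP[e /= e0 eU].
    apply: contrapT => SU; apply: hN; exists e => // x /eU Ux.
    by apply: contrapT => /eqP ax; apply: SU; exists x.
  by exists A => // x xA; apply: hA; rewrite /ball/= sub0r normrN.
exists A, (A + `|M| + 1); split => //; first by rewrite -addrA ltrDl ltr_wpDl.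
move=> x; rewrite negb_and -!ltNge => /orP[|xB]; first exact: hA.
apply: contrapT => /eqP ax.
have := hM (`|M| + 1) _ x; rewrite ltr_pwDr ?ler_norm// => /(_ erefl).
have Sx : csupport alpha x by exact: subset_closure.
move=> /(_ Sx); apply/negP; rewrite -ltNge (le_lt_trans _ xB)//.
by rewrite -addrA lerDr ltW.
Qed.

End ComplexParts.

Theorem theorem4p4 (R : realType) (alpha : R -> R[i])
  (alpha_smooth : csmooth alpha)
  (alpha_even : even_fun alpha)
  (alpha_supp : compact_support_away0 alpha) :
  has_fourier (coPoisson alpha) (coPoisson (inversion alpha)).
Proof.
have [A [B [A0 AB supp]]] := compact_support_away0_annulus alpha_supp.
case: alpha_smooth => sRe sIm.
have [iRe cosRe sinRe] := real_coPoisson_fourier sRe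
  (fun x => congr1 (@complex.Re R) (alpha_even x)) A0 AB
  (fun x hx => congr1 (@complex.Re R) (supp x hx)).
have [iIm cosIm sinIm] := real_coPoisson_fourier sIm
  (fun x => congr1 (@complex.Im R) (alpha_even x)) A0 AB
  (fun x hx => congr1 (@complex.Im R) (supp x hx)).
split.
  split; [move: iRe|move: iIm]; apply: eq_integrable => // y _; rewrite /comp.
    by rewrite Re_coPoisson.
  by rewrite Im_coPoisson.
(* Each part of the Fourier integral combines the cosine integral of one part of the co-Poisson sum
   with the sine integral of the other; the sine integrals vanish. *)
move=> w; apply/eqP; rewrite eq_complex Re_coPoisson Im_coPoisson Re_fourier Im_fourier.
rewrite (funext (Re_inversion alpha)) (funext (Im_inversion alpha)) -cosRe -cosIm.
under eq_Rintegral do rewrite Re_coPoisson Im_coPoisson.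
rewrite RintegralB//; last 2 first.
- exact: integrable_mul_bounded iRe (cosM_continuous (b := 2 * pi * w)) (fun y => cos_max _).
- exact: integrable_mul_bounded iIm (sinM_continuous (b := 2 * pi * w)) (fun y => sin_max _).
under [X in _ && (X == _)]eq_Rintegral do rewrite Re_coPoisson Im_coPoisson.
rewrite RintegralD//; last 2 first.
- exact: integrable_mul_bounded iIm (cosM_continuous (b := 2 * pi * w)) (fun y => cos_max _).
- exact: integrable_mul_bounded iRe (sinM_continuous (b := 2 * pi * w)) (fun y => sin_max _).
by rewrite sinRe sinIm subr0 addr0 !eqxx.
Qed.
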